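(* Let $G$ be an SE-graph with sources $r_1,\dots,r_m$ and sinks $c_1,\dots,c_n$, and let $\mathrm{Path}_G$ be its path matrix. Then for every $(I|J)\in\mathcal E^{m,n}$, $$[I|J]_{\mathrm{Path}_G,q}=\sum_{\phi\in\Phi(I|J)} w(\phi),$$ where $\Phi(I|J)$ is the set of $(I|J)$-flows in $G$.
   Context: Notation: $[p]=\{1,\dots,p\}$; $\mathcal E^{m,n}$ is the set of pairs $(I|J)$ with $I\subseteq[m]$, $J\subseteq[n]$, $|I|=|J|$. Fix a field $\mathbb K$ and $q\in\mathbb K^\ast$. An SE-graph is a finite directed graph $G=(V,E)$ embedded in the plane (planar with a fixed layout) such that: every edge is either a horizontal edge (H-edge) directed to the right or a vertical edge (V-edge) directed downward; there are distinguished vertices $r_1,\dots,r_m$ (sources) lying on a vertical line in this order upward, and $c_1,\dots,c_n$ (sinks) lying on a horizontal line in this order from left to right; sources are incident only with H-edges and sinks only with V-edges; every vertex lies on a directed path from a source to a sink. Let $W$ be the set of inner vertices (neither sources nor sinks). $\mathcal L_G$ is the $\mathbb K$-algebra of Laurent polynomials in the elements of $W$ with relations, for distinct $u,v\in W$: $uv=qvu$ if $G$ has a directed horizontal path from $u$ to $v$; $vu=quv$ if $G$ has a directed vertical path from $u$ to $v$; $uv=vu$ otherwise. Edge weights: $w(e)=v$ if $e=(u,v)$ with $u$ a source; $w(e)=u^{-1}v$ if $e=(u,v)$ is an H-edge with $u,v\in W$; $w(e)=1$ for V-edges. The weight of a directed path $e_1\cdots e_k$ is $w(e_1)\cdots w(e_k)$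 (ordered product). $\mathrm{Path}_G$ is the $m\times n$ matrix whose $(i,j)$ entry is the sum of weights of directed paths from $r_i$ to $c_j$. For $(I|J)\in\mathcal E^{m,n}$, an $(I|J)$-flow is a set of pairwise vertex-disjoint directed paths from the sources $\{r_i:i\in I\}$ to the sinks $\{c_j:j\in J\}$ (one path starting at each such source). Writing $I=\{i_1<\dots<i_k\}$, $J=\{j_1<\dots<j_k\}$, the $\ell$-th path $P_\ell$ of the flow starts at $r_{i_\ell}$ (and ends at $c_{j_\ell}$), and the weight of the flow $\phi=(P_1,\dots,P_k)$ is the ordered product $w(\phi)=w(P_1)\cdots w(P_k)$. The $q$-minor of a matrix $A=(a_{ij})$ is $[I|J]_{A,q}=\sum_{\sigma\in S_k}(-q)^{\ell(\sigma)}a_{i_1j_{\sigma(1)}}\cdots a_{i_kj_{\sigma(k)}}$ (product ordered left to right), with $\ell(\sigma)$ the number of inversions. *)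

(* Defs.v *)
From HB Require Import structures.
From mathcomp Require Import all_boot all_order all_algebra all_fingroup.
From mathcomp Require Import Rstruct.
Set Implicit Arguments. Unset Strict Implicit. Unset Printing Implicit Defensive.
Import Order.TTheory GRing.Theory Num.Theory.
Local Open Scope ring_scope.

Definition point := (Rdefinitions.R * Rdefinitions.R)%type.

Definition on_seg (a b z : point) : Prop :=
  exists t : Rdefinitions.R, 0 <= t <= 1 /\
    z = (a.1 + t * (b.1 - a.1), a.2 + t * (b.2 - a.2)).

(* Data of a directed graph drawn in the plane with distinguished sources
   r_0..r_{m-1} (= r_1..r_m of the paper) and sinks c_0..c_{n-1}.
   hedge = H-edges, vedge = V-edges. *)
Record SEgraph (m n : nat) := SEGraph {
  vert : finType;
  hedge : rel vert;
  vedge : rel vert;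
  pos : vert -> point;
  src : 'I_m -> vert;
  snk : 'I_n -> vert }.
Arguments vert {m n} s : rename.
Arguments hedge {m n} s : rename.
Arguments vedge {m n} s : rename.
Arguments pos {m n} s : rename.
Arguments src {m n} s : rename.
Arguments snk {m n} s : rename.

Section SE.
Variables (m n : nat) (G : SEgraph m n).

Definition edge : rel (vert G) := fun u v => hedge G u v || vedge G u v.

Definition is_src (v : vert G) : bool := [exists i, src G i == v].
Definition is_snk (v : vert G) : bool := [exists j, snk G j == v].
Definition inner (v : vert G) : bool := ~~ is_src v && ~~ is_snk v.

Record SE_axioms : Prop := {
  hedge_geom : forall u v, hedge G u v ->
     (pos G u).2 = (pos G v).2 /\ (pos G u).1 < (pos G v).1;
  vedge_geom : forall u v, vedge G u v ->
     (pos G u).1 = (pos G v).1 /\ (pos G v).2 < (pos G u).2;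
  (* planar embedding: distinct vertices at distinct points, no vertex in the
     interior of an edge, edges meet only at common endpoints *)
  pos_inj : injective (pos G);
  vertex_off_edges : forall w u v, edge u v ->
     on_seg (pos G u) (pos G v) (pos G w) -> w = u \/ w = v;
  edges_noncross : forall u v u' v' z, edge u v -> edge u' v' ->
     (u, v) <> (u', v') ->
     on_seg (pos G u) (pos G v) z -> on_seg (pos G u') (pos G v') z ->
     exists w, (w = u \/ w = v) /\ (w = u' \/ w = v') /\ z = pos G w;
  src_line : forall i i', (pos G (src G i)).1 = (pos G (src G i')).1;
  src_up : forall i i' : 'I_m, (i < i')%N ->
     (pos G (src G i)).2 < (pos G (src G i')).2;
  snk_line : forall j j', (pos G (snk G j)).2 = (pos G (snk G j')).2;
  snk_right : forall j j' : 'I_n, (j < j')%N ->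
     (pos G (snk G j)).1 < (pos G (snk G j')).1;
  src_not_snk : forall i j, src G i <> snk G j;
  src_no_in : forall i u, ~~ edge u (src G i);
  src_only_h : forall i u, ~~ vedge G (src G i) u && ~~ vedge G u (src G i);
  snk_no_out : forall j u, ~~ edge (snk G j) u;
  snk_only_v : forall j u, ~~ hedge G (snk G j) u && ~~ hedge G u (snk G j);
  on_src_snk_path : forall v, exists i j,
     connect edge (src G i) v /\ connect edge v (snk G j) }.

(* The algebra L_G is represented through its universal property: x maps the
   vertices (only inner ones matter) into a K-algebra A with inverses, such
   that the inner vertices are invertible and satisfy the q-commutation
   relations defining L_G. *)
Definition qtorus_rel (K : fieldType) (q : K) (A : unitAlgType K)
    (x : vert G -> A) : Prop :=
  (forall w, inner w -> x w \is a GRing.unit) /\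
  (forall u v, inner u -> inner v -> u != v ->
     (connect (hedge G) u v -> x u * x v = q *: (x v * x u)) /\
     (connect (vedge G) u v -> x v * x u = q *: (x u * x v)) /\
     (~~ connect (hedge G) u v -> ~~ connect (hedge G) v u ->
      ~~ connect (vedge G) u v -> ~~ connect (vedge G) v u ->
      x u * x v = x v * x u)).

Section Weights.
Variables (K : fieldType) (A : unitAlgType K) (x : vert G -> A).

Definition ew (u v : vert G) : A :=
  if hedge G u v then (if is_src u then x v else (x u)^-1 * x v) else 1.

(* A directed path starting at a is represented by the sequence p of the
   vertices following a; its edges are the consecutive pairs of a :: p. *)
Definition is_path (a b : vert G) (p : seq (vert G)) : bool :=
  path edge a p && (last a p == b).

Definition pw (a : vert G) (p : seq (vert G)) : A :=
  \prod_(e <- zip (a :: p) p) ew e.1 e.2.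

(* finite type of vertex sequences of length < #|V|; since G is acyclic
   (edges go right or down), every directed path is of this form. *)
Definition ptype := {l : 'I_#|vert G| & (l : nat).-tuple (vert G)}.
Definition pseq (p : ptype) : seq (vert G) := tagged p.

Definition pathmx : 'M[A]_(m, n) :=
  \matrix_(i, j) \sum_(p : ptype | is_path (src G i) (snk G j) (pseq p))
                    pw (src G i) (pseq p).
End Weights.
End SE.

(* the l-th smallest element (l = 0, ..., k-1) of a set I of size k *)
Definition elt (p : nat) (I : {set 'I_p}) (k : nat) (hI : #|I| = k)
  (l : 'I_k) : 'I_p := enum_val (cast_ord (esym hI) l).

Definition inv_count (k : nat) (s : 'S_k) : nat :=
  #|[set pr : 'I_k * 'I_k | (pr.1 < pr.2)%N && (s pr.2 < s pr.1)%N]|.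

Definition qminor (K : fieldType) (A : unitAlgType K) (m n : nat)
  (M : 'M[A]_(m, n)) (q : K) (I : {set 'I_m}) (J : {set 'I_n}) (k : nat)
  (hI : #|I| = k) (hJ : #|J| = k) : A :=
  \sum_(s : 'S_k) ((- q) ^+ inv_count s) *:
     \prod_(l < k) M (elt hI l) (elt hJ (s l)).

Definition is_flow (m n : nat) (G : SEgraph m n) (I : {set 'I_m})
  (J : {set 'I_n}) (k : nat) (hI : #|I| = k) (hJ : #|J| = k)
  (F : {ffun 'I_k -> ptype G}) : bool :=
  [forall l, [exists j in J, is_path (src G (elt hI l)) (snk G j) (pseq (F l))]]
  && [forall l, forall l', (l != l') ==>
        [disjoint (src G (elt hI l) :: pseq (F l))
                & (src G (elt hI l') :: pseq (F l'))]].

Definition flow_weight (m n : nat) (G : SEgraph m n) (K : fieldType)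
  (A : unitAlgType K) (x : vert G -> A) (I : {set 'I_m}) (k : nat)
  (hI : #|I| = k) (F : {ffun 'I_k -> ptype G}) : A :=
  \prod_(l < k) pw x (src G (elt hI l)) (pseq (F l)).

(* Main.v *)
(** Expanding the quantum minor gives a signed sum over pairs (permutation,
family of paths).  In a family that is not vertex-disjoint, planarity forces
the paths through a first shared vertex to start at two consecutive sources;
exchanging the tails of these two paths after their last common vertex [z]
composes the permutation with an adjacent transposition and preserves the
number of paths through each vertex, so it is an involution.  If the two tails
[P] and [Q] leave [z] downwards and to the right, the weights before and after
the exchange differ by a factor [q], which cancels against the factor [- q] of
the sign.

For this factor, let [reach r u v] be [1] if [r] leads from [u] to [v], [-1] if
it leads from [v] to [u], and [0] otherwise or if [u = v]; moving [x u] past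
[x v] then costs the exponent [reach (hedge G) u v - reach (vedge G) u v].  Along
an edge of [r], [reach r w] increases by the number of ends of the edge equal to
[w].  With [V := reach (vedge G)], it follows that the weight of every edge from
an inner [u] to [v], horizontal or vertical, commutes with [x w] up to the
exponent [V u w - V v w] minus the number of its ends equal to [w].  This
telescopes over a path from an inner [a] to [b], giving [V a w - V b w] minus the
number of edges of the path at [w]. *)

Require Import Defs.
From HB Require Import structures.
From mathcomp Require Import all_boot all_order all_algebra all_fingroup.
From mathcomp Require Import Rstruct ring lra zify.
Import Order.TTheory GRing.Theory Num.Theory.
Set Implicit Arguments.
Unset Strict Implicit.
Unset Printing Implicit Defensive.
Local Open Scope ring_scope.

(** * Reachability in directed graphs *)

Section Variation.
Variables (V : eqType) (r : rel V).
Implicit Types (a b u v w : V) (p : seq V) (f g : V -> int).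

Definition variation f a p : int :=
  \sum_(e <- zip (a :: p) p | r e.1 e.2) (f e.2 - f e.1).

Lemma variation_nil f a : variation f a [::] = 0.
Proof. exact: big_nil. Qed.

Lemma variation_cons f a b p :
  variation f a (b :: p) = (if r a b then f b - f a else 0) + variation f b p.
Proof. by rewrite /variation /= big_cons; case: ifP; rewrite ?add0r. Qed.

Lemma variationB f g a p :
  variation (fun w => f w - g w) a p = variation f a p - variation g a p.
Proof.
elim: p a => [|b p IHp] a; first by rewrite !variation_nil subr0.
by rewrite !variation_cons IHp; case: ifP => _; ring.
Qed.

Lemma variation_eq0 f a p :
  {in a :: p &, forall u v, r u v -> f u = f v} -> variation f a p = 0.
Proof.
elim: p a => [|b p IHp] a fE; first exact: variation_nil.
rewrite variation_cons IHp => [|u v up vp]; last first.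
  by apply: fE; rewrite in_cons ?up ?vp orbT.
by case: ifP => // ab; rewrite (fE a b) ?subrr // !inE eqxx ?orbT.
Qed.

Lemma variation_head f a b p : {in b :: p, forall w, f w = 0} ->
  variation f a (b :: p) = - (r a b)%:Z * f a.
Proof.
move=> f0; rewrite variation_cons variation_eq0 => [|u v up vp _].
  by rewrite f0 ?mem_head // sub0r addr0; case: ifP; rewrite ?mulN1r ?mul0r.
by rewrite !f0.
Qed.

(* The number of edges of the path [a :: p] that have [w] as an end. *)
Definition path_degree a p w : int :=
  (count_mem w (belast a p) + count_mem w p)%:Z.

Lemma path_degree_cons a b p w :
  path_degree a (b :: p) w = (w == a)%:Z + (w == b)%:Z + path_degree b p w.
Proof. by rewrite /path_degree /= !(eq_sym _ w) !PoszD addrACA. Qed.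

Lemma path_degree_notin a p w : w \notin a :: p -> path_degree a p w = 0.
Proof.
move=> wap; have wb : w \notin belast a p.
  by apply: contra wap; rewrite lastI mem_rcons in_cons orbC => ->.
have wp : w \notin p by apply: contra wap; rewrite in_cons orbC => ->.
by rewrite /path_degree (count_memPn wb) (count_memPn wp).
Qed.

Lemma path_degree_head a b p :
  a \notin b :: p -> path_degree a (b :: p) a = 1.
Proof.
move=> abp; rewrite path_degree_cons eqxx path_degree_notin //.
by move: abp; rewrite in_cons negb_or => /andP[/negbTE->].
Qed.

Lemma path_degree_last a p b :
  uniq (a :: rcons p b) -> path_degree a (rcons p b) b = 1.
Proof.
rewrite -rcons_cons rcons_uniq /path_degree belast_rcons => /andP[/[dup] bp].
rewrite inE negb_or => /andP[_ /count_memPn p0] _.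
by rewrite (count_memPn bp) -cats1 count_cat p0 /= eqxx.
Qed.

End Variation.

Section Reachability.
Variables (V : finType) (r : rel V).

Lemma connect_sub_preorder (le : rel V) :
  reflexive le -> transitive le -> subrel r le -> subrel (connect r) le.
Proof.
move=> le_refl le_trans r_le u v /connectP[p + ->].
elim: p u => [|w p IHp] u //= /andP[/r_le uw /IHp]; exact: le_trans.
Qed.

Lemma path_connect_last a p v :
  path r a p -> v \in a :: p -> connect r v (last a p).
Proof.
move=> ap vp; case/splitPl: vp ap => p1 p2 <-; rewrite cat_path last_cat.
by case/andP=> _ p2P; apply/connectP; exists p2.
Qed.

Lemma path_pred a p v :
  path r a p -> v \in p -> exists2 u, u \in a :: p & r u v.
Proof.
move=> ap vp; case/path.splitP: vp ap => p1 p2.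
rewrite cat_path rcons_path => /andP[/andP[_ lv] _].
exists (last a p1) => //.
by rewrite -cat_cons mem_cat -rcons_cons -cats1 mem_cat mem_last.
Qed.

Definition reach (u v : V) : int := (connect r u v)%:Z - (connect r v u)%:Z.

Lemma reach_antisym u v : reach v u = - reach u v.
Proof. by rewrite /reach opprB. Qed.

Lemma reachxx u : reach u u = 0.
Proof. exact: subrr. Qed.

Record disjoint_lines : Prop := DisjointLines {
  out_inj : forall u v w, r u v -> r u w -> v = w;
  in_inj : forall u v w, r v u -> r w u -> v = w;
  acyclic : forall u v, r u v -> ~~ connect r v u }.

Hypothesis r_lines : disjoint_lines.

Lemma connect_tail u v w : r u v -> w != u -> connect r v w = connect r u w.
Proof.
move=> uv wu; apply/idP/idP; first exact/connect_trans/connect1.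
case/connectP=> -[/= _ wE|b p /= /andP[ub bp] ->].
  by rewrite wE eqxx in wu.
by rewrite (out_inj r_lines uv ub); apply/connectP; exists p.
Qed.

Lemma connect_head u v w : r u v -> w != v -> connect r w v = connect r w u.
Proof.
move=> uv wv; apply/idP/idP; last first.
  by move/connect_trans; apply; apply: connect1.
case/connectP=> p; case: (lastP p) => [/= _ vE|{}p b].
  by rewrite vE eqxx in wv.
rewrite rcons_path last_rcons => /andP[wp pb] vE; rewrite -vE in pb.
by rewrite (in_inj r_lines uv pb); apply/connectP; exists p.
Qed.

Lemma reach_edge u v w :
  r u v -> reach w v - reach w u = (w == u)%:Z + (w == v)%:Z.
Proof.
move=> uv; have /negbTE vu := acyclic r_lines uv; rewrite /reach.
have [-> | wu] := eqVneq w u.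
  rewrite (connect1 uv) vu connect0; case: eqVneq => // uE.
  by rewrite -uE connect0 in vu.
have [-> | wv] := eqVneq w v; first by rewrite (connect1 uv) vu connect0.
by rewrite (connect_tail uv wu) (connect_head uv wv) subrr.
Qed.

Lemma variation_reach_notin w a p :
  w \notin a :: p -> variation r (reach w) a p = 0.
Proof.
move=> wp; apply: variation_eq0 => u v up vp uv; apply/esym/eqP.
rewrite -subr_eq0 reach_edge //.
have /negbTE-> : w != u by apply: contraNneq wp => ->.
by have /negbTE-> : w != v by apply: contraNneq wp => ->.
Qed.

Lemma variation_reach_head a b p :
  a \notin b :: p -> variation r (reach a) a (b :: p) = (r a b)%:Z.
Proof.
move=> abp; rewrite variation_cons variation_reach_notin // addr0.
case: ifP => // ab; rewrite reach_edge // eqxx.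
by move: abp; rewrite inE negb_or => /andP[/negbTE->].
Qed.

End Reachability.

(** * Exchanging the tails of two meeting paths *)

Section TailExchange.
Variables (V : finType) (r : rel V).
Variables (d : Order.disp_t) (T : orderType d) (rk : V -> T).
Hypothesis rk_homo : {homo rk : u v / r u v >-> (u < v)%O}.
Implicit Types (a b u v w z : V) (p : seq V).

Let rk_path a p : path r a p -> sorted (relpre rk <%O) (a :: p).
Proof. exact/sub_path/rk_homo. Qed.

Let rk_trans : transitive (relpre rk <%O).
Proof. move=> v u w; exact: lt_trans. Qed.

Lemma path_uniq a p : path r a p -> uniq (a :: p).
Proof. by move/rk_path/(sorted_uniq rk_trans); apply=> u; apply: ltxx. Qed.

Lemma path_size a p : path r a p -> (size p < #|V|)%N.
Proof. by move/path_uniq/card_uniqP => /= <-; apply: max_card. Qed.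

Lemma path_cat_rank a p p' u v :
  path r a (p ++ p') -> u \in a :: p -> v \in p' -> (rk u < rk v)%O.
Proof.
move/rk_path; rewrite -cat_cons sorted_pairwise // pairwise_cat.
by case/and3P=> /allrelP + _ _; apply.
Qed.

Definition last_meet p p' : option V :=
  [pick z | [&& z \in p, z \in p' &
    [forall w, (w \in p) && (w \in p') ==> (rk w <= rk z)%O]]].

Definition exchange_tails p p' : seq V :=
  if last_meet p p' is Some z
  then take (index z p).+1 p ++ drop (index z p').+1 p' else p.

Lemma exchange_tails_id p : exchange_tails p p = p.
Proof.
by rewrite /exchange_tails; case: last_meet => // z; apply: cat_take_drop.
Qed.

Variant meeting_spec a b w : seq V -> seq V -> Prop :=
  MeetingSpec z p1 p2 p1' p2' of path r a (rcons p1 z ++ p2)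
    & path r b (rcons p1' z ++ p2') & [disjoint p2 & p2'] & (rk w <= rk z)%O :
  meeting_spec a b w (rcons p1 z ++ p2) (rcons p1' z ++ p2').

Lemma meetingP a b p p' w : path r a p -> path r b p' ->
  w \in p -> w \in p' -> meeting_spec a b w p p'.
Proof.
move=> ap bp wp wp'; have common_w : (w \in p) && (w \in p') by apply/andP.
case: (arg_maxP (P := fun v => (v \in p) && (v \in p')) rk common_w).
move=> z /andP[zp zp'] zmax; have wz : (rk w <= rk z)%O := zmax w common_w.
case/path.splitP: zp ap zmax {wp common_w} => p1 p2 ap.
case/path.splitP: zp' bp {wp'} => p1' p2' bp zmax.
split=> //; rewrite disjoint_has; apply/hasPn => v vp2; apply/negP => vp2'.
have /zmax : (v \in rcons p1 z ++ p2) && (v \in rcons p1' z ++ p2').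
  by rewrite !mem_cat vp2 [v \in p2']vp2' !orbT.
by rewrite /= leNgt (path_cat_rank ap _ vp2) // inE mem_rcons mem_head orbT.
Qed.

Section Tails.
Variables (a b z : V) (p1 p2 p1' p2' : seq V).
Local Notation p := (rcons p1 z ++ p2).
Local Notation p' := (rcons p1' z ++ p2').
Hypotheses (ap : path r a p) (bp : path r b p').
Hypothesis tails_disj : [disjoint p2 & p2'].

Lemma last_meetE : last_meet p p' = Some z.
Proof.
have zp1 s : z \in rcons s z by rewrite mem_rcons mem_head.
have front c s s' v : path r c (rcons s z ++ s') -> v \in rcons s z ->
    v = z \/ (rk v < rk z)%O.
  rewrite cat_path mem_rcons inE -cats1.
  move=> /andP[cs _] /predU1P[|vs]; first by left.
  by right; apply: path_cat_rank cs _ (mem_head _ _); rewrite inE vs orbT.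
have common v : v \in p -> v \in p' -> v = z \/ (rk v < rk z)%O.
  rewrite !mem_cat => /orP[v1|v2] /orP[v1'|v2']; first exact: front ap v1.
  - exact: front ap v1.
  - exact: front bp v1'.
  - by move: tails_disj; rewrite disjoint_has => /hasPn/(_ v v2)/negP[].
rewrite /last_meet; case: pickP => [w /and3P[wp wp' /forallP/(_ z)]|/(_ z)].
  rewrite !mem_cat !zp1 /= leNgt => zw; congr Some.
  by have [//|wz] := common w wp wp'; rewrite wz in zw.
rewrite !mem_cat !zp1 /= => /forallP[] w; apply/implyP => /andP[wp wp'].
by have [->|/ltW] := common w wp wp'.
Qed.

Lemma exchange_tailsE : exchange_tails p p' = rcons p1 z ++ p2'.
Proof.
have idx c s s' : path r c (rcons s z ++ s') ->
    index z (rcons s z ++ s') = size s.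
  move/path_uniq; rewrite cons_uniq cat_uniq rcons_uniq.
  case/and4P=> _ /andP[/negbTE zs _] _ _.
  by rewrite index_cat mem_rcons mem_head -cats1 index_cat zs /= eqxx addn0.
rewrite /exchange_tails last_meetE (idx a) // (idx b) // -{1}(size_rcons p1 z).
by rewrite -(size_rcons p1' z) take_size_cat // drop_size_cat.
Qed.

Lemma path_exchange_cat : path r a (rcons p1 z ++ p2').
Proof.
move: ap bp; rewrite !cat_path !last_rcons.
by case/andP=> -> _ /andP[].
Qed.

End Tails.

Section MeetingPaths.
Variables (a b w : V) (p p' : seq V).
Hypotheses (ap : path r a p) (bp : path r b p') (wp : w \in p) (wp' : w \in p').

Lemma path_exchange_tails : path r a (exchange_tails p p').
Proof.
case: (meetingP ap bp wp wp') => z p1 p2 p1' p2' az bz tails _.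
by rewrite (exchange_tailsE az bz tails) (path_exchange_cat az bz).
Qed.

Lemma last_exchange_tails : last a (exchange_tails p p') = last b p'.
Proof.
case: (meetingP ap bp wp wp') => z p1 p2 p1' p2' az bz tails _.
by rewrite (exchange_tailsE az bz tails) !last_cat !last_rcons.
Qed.

Lemma exchange_tailsK :
  exchange_tails (exchange_tails p p') (exchange_tails p' p) = p.
Proof.
case: (meetingP ap bp wp wp') => z p1 p2 p1' p2' az bz tails _.
have tails' : [disjoint p2' & p2] by rewrite disjoint_sym.
rewrite (exchange_tailsE az bz tails) (exchange_tailsE bz az tails').
have az' := path_exchange_cat az bz; have bz' := path_exchange_cat bz az.
exact: exchange_tailsE az' bz' tails'.
Qed.

Lemma count_exchange_tails (P : pred V) :
  (count P (exchange_tails p p') + count P (exchange_tails p' p) =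
   count P p + count P p')%N.
Proof.
case: (meetingP ap bp wp wp') => z p1 p2 p1' p2' az bz tails _.
have tails' : [disjoint p2' & p2] by rewrite disjoint_sym.
rewrite (exchange_tailsE az bz tails) (exchange_tailsE bz az tails') !count_cat.
by rewrite addnACA [RHS]addnACA [(count P p2 + _)%N]addnC.
Qed.

Lemma mem_exchange_tails v :
  (rk v <= rk w)%O -> (v \in exchange_tails p p') = (v \in p).
Proof.
case: (meetingP ap bp wp wp') => z p1 p2 p1' p2' az bz tails wz vw.
have off c s s' : path r c (rcons s z ++ s') -> v \in s' = false.
  move=> cs; apply: contraTF (le_trans vw wz) => vs'; rewrite -ltNge.
  by apply: path_cat_rank cs _ vs'; rewrite inE mem_rcons mem_head orbT.
rewrite (exchange_tailsE az bz tails) !mem_cat.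
by rewrite (off a p1 p2) // (off b p1' p2').
Qed.

End MeetingPaths.
End TailExchange.

(** * Permutations and sign-reversing involutions *)

Lemma sorted_enum_ord p (P : pred 'I_p) : sorted (relpre val ltn) (enum P).
Proof.
apply: sorted_filter; first by move=> j i l; apply: ltn_trans.
by rewrite -enumT -sorted_map val_enum_ord iota_ltn_sorted.
Qed.

Lemma perm_increasing k (s : 'S_k) : {homo s : i j / (i < j)%N} -> s = 1%g.
Proof.
move=> s_incr; apply/permP => i; rewrite perm1.
have : map s (enum 'I_k) = map id (enum 'I_k).
  apply: (irr_sorted_eq (leT := relpre val ltn)) => [j l t|j|||j].
  - exact: ltn_trans.
  - exact: ltnn.
  - by rewrite sorted_map; apply: sub_sorted (sorted_enum_ord _).
  - by rewrite map_id; apply: sorted_enum_ord.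
  by rewrite map_id -(permKV s j) (mem_map perm_inj) !mem_enum.
by move/eq_in_map/(_ i); rewrite mem_enum; apply.
Qed.

Lemma inv_count1 k : inv_count (1 : 'S_k) = 0%N.
Proof.
apply/eqP; rewrite cards_eq0; apply/eqP/setP => -[i j]; rewrite !inE !perm1 /=.
by case: ltngtP.
Qed.

Section AdjacentTransposition.
Variables (k : nat) (a b : 'I_k).
Hypothesis ab : b = a.+1 :> nat.

Lemma tperm_adjacent_lt (i j : 'I_k) : (i < j)%N -> (i, j) != (a, b) ->
  (tperm a b i < tperm a b j)%N.
Proof.
rewrite xpair_eqE negb_and.
by do 2!case: tpermP => [->|->|/eqP + /eqP +]; rewrite -?val_eqE /= ?ab; lia.
Qed.

Lemma inv_count_tperm (s : 'S_k) : (s a < s b)%N ->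
  inv_count (tperm a b * s)%g = (inv_count s).+1.
Proof.
move=> sab; pose inversions (u : 'S_k) :=
  [set c : 'I_k * 'I_k | (c.1 < c.2)%N && (u c.2 < u c.1)%N].
rewrite -[inv_count _]/#|inversions _| -[inv_count s]/#|inversions s|.
pose f (c : 'I_k * 'I_k) := (tperm a b c.1, tperm a b c.2).
have fK : involutive f by case=> i j; rewrite /f /= !tpermK.
have f_ab : f (a, b) = (b, a) by rewrite /f /= tpermL tpermR.
have -> : inversions (tperm a b * s)%g = (a, b) |: f @: inversions s.
  apply/setP => -[i j]; rewrite in_setU1 -[X in X \in f @: _](fK (i, j)).
  rewrite (mem_imset _ _ (inv_inj fK)) !inE !permM /=.
  have [[-> ->]|ij_ab] /= := eqVneq (i, j) (a, b).
    by rewrite tpermL tpermR sab ab leqnn.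
  have [lij|lji] := ltnP i j; first by rewrite tperm_adjacent_lt.
  apply/esym/negP => /andP[lt_tperm lt_s].
  have [[ia jb]|fij_ab] := eqVneq (tperm a b i, tperm a b j) (a, b).
    by rewrite ia jb ltnNge (ltnW sab) in lt_s.
  by have := tperm_adjacent_lt lt_tperm fij_ab; rewrite !tpermK ltnNge lji.
rewrite cardsU1 (card_imset _ (inv_inj fK)) -[X in X \notin _](fK (a, b)) f_ab.
by rewrite (mem_imset _ _ (inv_inj fK)) inE /= ab ltnNge leqnSn add1n.
Qed.

Lemma prod_adjacent_scale (K : pzRingType) (A : algType K)
    (f g : 'I_k -> A) (c : K) :
  (forall l, l != a -> l != b -> g l = f l) ->
  g a * g b = c *: (f a * f b) ->
  \prod_(l < k) g l = c *: \prod_(l < k) f l.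
Proof.
move=> gf gab; have ak : (a.+2 <= k)%N by rewrite -ab.
have splitE (F : 'I_k -> A) : \prod_(l < k) F l =
    (\prod_(0 <= i < a) F (insubd a i)) * (F a * F b)
    * \prod_(a.+2 <= i < k) F (insubd a i).
  transitivity (\prod_(0 <= i < k) F (insubd a i)).
    by rewrite big_mkord; apply: eq_bigr => l _; rewrite valKd.
  rewrite (big_cat_nat _ (n := a)) ?(ltnW (ltnW ak)) //=.
  rewrite (big_ltn (ltnW ak)) (big_ltn ak) mulrA mulrA.
  by rewrite -(mulrA _ (F _) (F _)) -ab !valKd.
have off (i : nat) : i != a -> i != b -> (i < k)%N ->
    g (insubd a i) = f (insubd a i).
  by move=> ia ib ik; apply: gf; rewrite -val_eqE insubdK.
rewrite !splitE gab -scalerAr -scalerAl; congr (_ *: (_ * _ * _)).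
  by apply: eq_big_nat => i ia; apply: off; lia.
by apply: eq_big_nat => i ai; apply: off; lia.
Qed.

End AdjacentTransposition.

Lemma sum_sign_reversing (W : zmodType) (T : finType) (P up : pred T)
    (f : T -> T) (w : T -> W) :
  (forall c, P c -> P (f c)) -> (forall c, P c -> f (f c) = c) ->
  (forall c, P c -> up (f c) = ~~ up c) ->
  (forall c, P c -> up c -> w (f c) = - w c) ->
  \sum_(c | P c) w c = 0.
Proof.
move=> fP fK f_up fw; rewrite (bigID up) /= addrC.
rewrite (reindex_onto f f) /= => [|c /andP[Pc _]]; last exact: fK.
have dom c : P (f c) && ~~ up (f c) && (f (f c) == c) = P c && up c.
  apply/andP/andP => [[/andP[Pfc up_fc] /eqP fc]|[Pc up_c]].
    by rewrite -fc fP // f_up.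
  by rewrite fP // f_up // up_c fK // eqxx.
rewrite (eq_bigl _ _ dom) -big_split big1 //= => c /andP[Pc up_c].
by rewrite fw // addNr.
Qed.

Section Elt.
Variables (p : nat) (I : {set 'I_p}) (k : nat) (hI : #|I| = k).

Lemma elt_in l : elt hI l \in I.
Proof. exact: enum_valP. Qed.

Lemma elt_inj : injective (elt hI).
Proof. by move=> l l' /enum_val_inj/cast_ord_inj. Qed.

Lemma elt_onto i : i \in I -> exists l, i = elt hI l.
Proof.
move=> iI; exists (cast_ord hI (enum_rank_in iI i)).
by rewrite /elt cast_ordK enum_rankK_in.
Qed.

Lemma elt_lt : {homo elt hI : l l' / (l < l')%N}.
Proof.
move=> l l' ll'; have i0 := elt hI l; rewrite /elt !(enum_val_nth i0).
have trans : transitive (relpre (val : 'I_p -> nat) ltn).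
  by move=> j i t; apply: ltn_trans.
apply: (sorted_ltn_nth trans i0 (sorted_enum_ord _)) => //.
  by rewrite inE -cardE [X in (_ < X)%N]hI /=.
by rewrite inE -cardE [X in (_ < X)%N]hI /=.
Qed.

Lemma elt_lt_mono (l l' : 'I_k) : (elt hI l < elt hI l')%N = (l < l')%N.
Proof.
have [/elt_lt//|l'l] := ltnP l l'; apply/negbTE; rewrite -leqNgt.
by move: l'l; rewrite leq_eqVlt => /predU1P[/val_inj->//|/elt_lt/ltnW].
Qed.

End Elt.

(** * Commutation up to a power of [q] *)

Section QCommutation.
Variables (K : fieldType) (q : K) (A : unitAlgType K).
Hypothesis q_neq0 : q != 0.
Implicit Types (e f : int) (a b c : A).

Definition qcomm e a b : Prop := a * b = q ^ e *: (b * a).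

Lemma qcomm_sym e a b : qcomm e a b -> qcomm (- e) b a.
Proof.
by move=> ab; rewrite /qcomm ab scalerA -expfzDr // addNr expr0z scale1r.
Qed.

Lemma qcomm1r a : qcomm 0 a 1.
Proof. by rewrite /qcomm expr0z scale1r mul1r mulr1. Qed.

Lemma qcomm1l a : qcomm 0 1 a.
Proof. by rewrite /qcomm expr0z scale1r mul1r mulr1. Qed.

Lemma qcommMr e f a b c : qcomm e c a -> qcomm f c b -> qcomm (e + f) c (a * b).
Proof.
move=> ca cb; rewrite /qcomm mulrA ca -scalerAl -(mulrA a c) cb -scalerAr.
by rewrite scalerA -expfzDr // mulrA.
Qed.

Lemma qcommMl e f a b c : qcomm e a c -> qcomm f b c -> qcomm (e + f) (a * b) c.
Proof.
move=> /qcomm_sym ca /qcomm_sym cb; rewrite -[e + f]opprK opprD.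
exact/qcomm_sym/qcommMr.
Qed.

Lemma qcommVr e a c : a \is a GRing.unit -> qcomm e c a -> qcomm (- e) c a^-1.
Proof.
move=> ua /qcomm_sym ac; apply: (mulrI ua); apply: (mulIr ua).
by rewrite mulrA mulrVK // ac -scalerAr -scalerAl mulrA divrr // mul1r.
Qed.

Lemma qcommVl e a c : a \is a GRing.unit -> qcomm e a c -> qcomm (- e) a^-1 c.
Proof. by move=> ua /qcomm_sym/(qcommVr ua)/qcomm_sym; rewrite opprK. Qed.

Lemma qcomm_rev3 e f g a b c : qcomm e a b -> qcomm f a c -> qcomm g b c ->
  a * b * c = q ^ (e + f + g) *: (c * b * a).
Proof.
move=> ab ac bc; rewrite ab -scalerAl -(mulrA b a c) ac -scalerAr mulrA bc.
by rewrite -!scalerAl !scalerA -!expfzDr.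
Qed.

End QCommutation.

(** * Planar drawings with edges directed right and down *)

Section Drawing.
Variables (R : realDomainType) (V : finType).
Implicit Types (h v : rel V) (X Y : V -> R) (a b c s t u w : V) (p : seq V).

Record SE_drawing h v X Y : Prop := SEDrawing {
  drawing_inj : forall u w, X u = X w -> Y u = Y w -> u = w;
  h_right : forall a b, h a b -> Y a = Y b /\ X a < X b;
  v_down : forall a b, v a b -> X a = X b /\ Y b < Y a;
  h_free : forall a b w,
    h a b -> Y a = Y w -> X a <= X w <= X b -> w \in [:: a; b];
  v_free : forall a b w,
    v a b -> X a = X w -> Y b <= Y w <= Y a -> w \in [:: a; b];
  hv_cross : forall a b s t, h a b -> v s t ->
    X a <= X s <= X b -> Y t <= Y a <= Y s ->
    exists2 w, w \in [:: a; b] & w \in [:: s; t] }.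

(* Reflection in the line [X + Y = 0], which exchanges right and down. *)
Lemma drawing_transpose h v X Y :
  SE_drawing h v X Y -> SE_drawing v h (fun w => - Y w) (fun w => - X w).
Proof.
case=> inj hr vd hf vf hv; split=> [u w|||a b w ab|a b w ab|].
- by move=> /oppr_inj Yu /oppr_inj Xu; apply: inj.
- by move=> a b /vd[-> Yba]; rewrite ltrN2.
- by move=> a b /hr[-> Xab]; rewrite ltrN2.
- by move=> /oppr_inj Xa; rewrite !lerN2 andbC; apply: vf.
- by move=> /oppr_inj Ya; rewrite !lerN2 andbC; apply: hf.
- move=> a b s t ab st; rewrite !lerN2 andbC => Ys; rewrite andbC => Xa.
  by have [w] := hv _ _ _ _ st ab Xa Ys; exists w.
Qed.

Lemma drawing_reverse h v X Y : SE_drawing h v X Y ->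
  SE_drawing (fun a b => h b a) (fun a b => v b a)
    (fun w => - X w) (fun w => - Y w).
Proof.
case=> inj hr vd hf vf hv; split=> [u w|||a b w ab|a b w ab|].
- by move=> /oppr_inj Xu /oppr_inj Yu; apply: inj.
- by move=> a b /hr[-> Xba]; rewrite ltrN2.
- by move=> a b /vd[-> Yab]; rewrite ltrN2.
- move=> /oppr_inj Ya; rewrite !lerN2 andbC mem_seq2 orbC -mem_seq2.
  by apply: hf; rewrite // -Ya; have [] := hr _ _ ab.
- move=> /oppr_inj Xa; rewrite !lerN2 andbC mem_seq2 orbC -mem_seq2.
  by apply: vf; rewrite // -Xa; have [] := vd _ _ ab.
- move=> a b s t ab st; rewrite !lerN2 andbC => Xs; rewrite andbC => Ya.
  have [Yba _] := hr _ _ ab; have [Xts _] := vd _ _ st.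
  have [||w] := hv _ _ _ _ ab st; rewrite ?Yba ?Xts //.
  by rewrite !mem_seq2 => wab wst; exists w; rewrite mem_seq2 orbC.
Qed.

Lemma h_out_inj h v X Y : SE_drawing h v X Y ->
  forall u a b, h u a -> h u b -> a = b.
Proof.
move=> D u a b; wlog Xab : a b / X a <= X b => [IH ua ub|ua ub].
  by have [/IH->|/ltW/IH->] := leP (X a) (X b).
have [[Yua Xua] _] := (h_right D ua, h_right D ub).
have : a \in [:: u; b] by apply: (h_free D ub); rewrite ?Yua // ltW.
by rewrite mem_seq2 => /orP[/eqP au|/eqP//]; rewrite au ltxx in Xua.
Qed.

Lemma v_out_inj h v X Y : SE_drawing h v X Y ->
  forall u a b, v u a -> v u b -> a = b.
Proof. by move/drawing_transpose/h_out_inj. Qed.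

Lemma h_in_inj h v X Y : SE_drawing h v X Y ->
  forall u a b, h a u -> h b u -> a = b.
Proof. by move/drawing_reverse/h_out_inj. Qed.

Lemma v_in_inj h v X Y : SE_drawing h v X Y ->
  forall u a b, v a u -> v b u -> a = b.
Proof. by move/drawing_transpose/h_in_inj. Qed.

Lemma connect_h_right h v X Y : SE_drawing h v X Y ->
  forall u w, connect h u w -> Y u = Y w /\ X u <= X w.
Proof.
move=> D u w; pose right_of := [rel a b | (Y a == Y b) && (X a <= X b)].
suff sub : subrel (connect h) right_of by case/sub/andP=> /eqP.
apply: connect_sub_preorder => [a|b a c|a b /(h_right D)[Yab Xab]] /=.
- by rewrite eqxx lexx.
- by move=> /andP[/eqP-> Xab] /andP[-> Xbc]; apply: le_trans Xbc.
- by rewrite Yab eqxx ltW.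
Qed.

Lemma connect_v_down h v X Y : SE_drawing h v X Y ->
  forall u w, connect v u w -> X u = X w /\ Y w <= Y u.
Proof.
move=> /drawing_transpose D u w /(connect_h_right D)[/oppr_inj].
by rewrite lerN2.
Qed.

Lemma connect_h_exclusive h v X Y : SE_drawing h v X Y ->
  forall u w, u != w -> connect h u w ->
  [/\ ~~ connect h w u, ~~ connect v u w & ~~ connect v w u].
Proof.
move=> D u w uw /(connect_h_right D)[Yuw Xuw]; split; apply: contra uw.
- move=> /(connect_h_right D)[_ Xwu].
  by apply/eqP/(drawing_inj D) => //; apply/le_anti/andP.
- by move=> /(connect_v_down D)[Xuw' _]; apply/eqP/(drawing_inj D).
- by move=> /(connect_v_down D)[Xuw' _]; apply/eqP/(drawing_inj D).
Qed.

Lemma connect_v_exclusive h v X Y : SE_drawing h v X Y ->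
  forall u w, u != w -> connect v u w ->
  [/\ ~~ connect v w u, ~~ connect h u w & ~~ connect h w u].
Proof. by move/drawing_transpose/connect_h_exclusive. Qed.

Lemma h_lines h v X Y : SE_drawing h v X Y -> disjoint_lines h.
Proof.
move=> D; split; [exact: h_out_inj D | exact: h_in_inj D |].
move=> a b /(h_right D)[_ Xab].
by apply: contraTN Xab => /(connect_h_right D)[_]; rewrite -leNgt.
Qed.

Lemma v_lines h v X Y : SE_drawing h v X Y -> disjoint_lines v.
Proof. by move/drawing_transpose/h_lines. Qed.

Lemma h_edge_not_v h v X Y : SE_drawing h v X Y ->
  forall a b, h a b -> v a b = false.
Proof.
move=> D a b /(h_right D)[_ Xab]; apply: contraTF Xab => /(v_down D)[-> _].
by rewrite ltxx.
Qed.

Lemma connect_SE h v X Y : SE_drawing h v X Y ->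
  forall u w, connect (relU h v) u w -> X u <= X w /\ Y w <= Y u.
Proof.
move=> D u w; pose SE_of := [rel a b | (X a <= X b) && (Y b <= Y a)].
suff sub : subrel (connect (relU h v)) SE_of by move/sub/andP.
apply: connect_sub_preorder => [a|b a c|a b] /=.
- by rewrite !lexx.
- by case/andP=> ab ba /andP[bc cb]; rewrite (le_trans ab) ?(le_trans cb).
- by case/orP=> [/(h_right D)|/(v_down D)][-> /ltW->]; rewrite lexx.
Qed.

Lemma edge_SE_rank h v X Y : SE_drawing h v X Y ->
  {homo (fun u => X u - Y u) : a b / relU h v a b >-> a < b}.
Proof. by move=> D a b /orP[/(h_right D)|/(v_down D)] [? ?]; lra. Qed.

Definition northeast X Y (P : seq V) u :=
  has (fun w => (X w <= X u) && (Y w <= Y u)) P.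

Definition southwest X Y (P : seq V) u :=
  has (fun w => (X u <= X w) && (Y u <= Y w)) P.

Lemma northeast_transpose X Y P :
  northeast (fun w => - Y w) (fun w => - X w) P =1 southwest X Y P.
Proof. by move=> u; apply: eq_has => w /=; rewrite !lerN2 andbC. Qed.

Lemma southwest_transpose X Y P :
  southwest (fun w => - Y w) (fun w => - X w) P =1 northeast X Y P.
Proof. by move=> u; apply: eq_has => w /=; rewrite !lerN2 andbC. Qed.

Lemma northeast_last h v X Y a p u : SE_drawing h v X Y ->
  path (relU h v) a p -> northeast X Y (a :: p) u -> Y (last a p) <= Y u.
Proof.
move=> D ap /hasP[w wp /andP[_]]; apply: le_trans.
by have [] := connect_SE D (path_connect_last ap wp).
Qed.

Lemma southwest_last h v X Y a p u : SE_drawing h v X Y ->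
  path (relU h v) a p -> southwest X Y (a :: p) u -> X u <= X (last a p).
Proof.
move=> D ap /hasP[w wp /andP[Xuw _]]; apply: le_trans Xuw _.
by have [] := connect_SE D (path_connect_last ap wp).
Qed.

(* A directed path is a staircase descending to the right, so the region
   northeast of it can only be left by a vertical edge beyond its end. *)
Lemma northeast_v_edge h v X Y a p u w : SE_drawing h v X Y ->
  path (relU h v) a p -> v u w -> u \notin a :: p -> w \notin a :: p ->
  northeast X Y (a :: p) u ->
  northeast X Y (a :: p) w \/ X (last a p) <= X u /\ Y w < Y (last a p).
Proof.
move=> D + uw; have [Xuw Ywu] := v_down D uw.
have NE_head b p' : X b <= X u -> Y b <= Y w -> northeast X Y (b :: p') w.
  by move=> Xbu Ybw; rewrite /northeast /= -Xuw Xbu Ybw.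
elim: p a => [|b p IHp] a.
  move=> _ _ _ /orP[/andP[Xau Yau]|//].
  have [Yaw|Ywa] := leP (Y a) (Y w); [by left; apply: NE_head | by right].
move=> /andP[ab bp]; rewrite in_cons negb_or => /andP[ua ub].
rewrite in_cons negb_or => /andP[wa wb] NEu.
have [Xab Yba] := connect_SE D (connect1 ab).
have [Xbu|Xub] := leP (X b) (X u).
  have [|NEw|] := IHp b bp ub wb; last by right.
    case/orP: NEu => [/andP[_ Yau]|//].
    by rewrite /northeast /= Xbu (le_trans Yba Yau).
  by left; apply/orP; right.
have {NEu} /andP[Xau Yau] : (X a <= X u) && (Y a <= Y u).
  case/hasP: NEu => y; rewrite in_cons => /predU1P[->//|yp] /andP[Xyu _].
  have [Xby _] := connect_SE D (path_connect bp yp).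
  by have := le_lt_trans (le_trans Xby Xyu) Xub; rewrite ltxx.
have [Yaw|Ywa] := leP (Y a) (Y w); first by left; apply: NE_head.
have hab : h a b.
  case/orP: ab => // /(v_down D)[XabE _].
  by have := le_lt_trans Xau Xub; rewrite XabE ltxx.
have [||y] := hv_cross D hab uw; rewrite ?Xau ?(ltW Xub) ?Yau ?(ltW Ywa) //.
rewrite !mem_seq2 => yab /orP[]/eqP yuw; subst y.
- by move: yab ub; rewrite (negbTE ua) in_cons => /= ->.
- by move: yab wb; rewrite (negbTE wa) in_cons => /= ->.
Qed.

Lemma northeast_edge h v X Y a p u w : SE_drawing h v X Y ->
  path (relU h v) a p -> relU h v u w -> u \notin a :: p -> w \notin a :: p ->
  northeast X Y (a :: p) u ->
  northeast X Y (a :: p) w \/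
  [/\ v u w, X (last a p) <= X u & Y w < Y (last a p)].
Proof.
move=> D ap /orP[/(h_right D)[Yuw Xuw] _ _ NEu|uw ua wa NEu].
  left; apply: sub_has NEu => y /andP[Xyu Yyu].
  by rewrite -Yuw Yyu (le_trans Xyu (ltW Xuw)).
by have [|[]] := northeast_v_edge D ap uw ua wa NEu; [left | right].
Qed.

Lemma northeast_path h v X Y a p c r : SE_drawing h v X Y ->
  path (relU h v) a p -> path (relU h v) c r -> [disjoint c :: r & a :: p] ->
  Y (last a p) <= Y (last c r) ->
  northeast X Y (a :: p) c -> northeast X Y (a :: p) (last c r).
Proof.
move=> D ap; elim: r c => [|d r IHr] c //= /andP[cd dr].
rewrite disjoint_cons => /andP[cp drp] Yle NEc; apply: IHr => //.
have dp : d \notin a :: p by move: drp; rewrite disjoint_cons => /andP[].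
have [//|[_ _]] := northeast_edge D ap cd cp dp NEc.
have [_ Yd] := connect_SE D (path_connect_last dr (mem_head _ _)).
by rewrite ltNge (le_trans Yle Yd).
Qed.

Lemma trapped_edge h v X Y a p b p' c d : SE_drawing h v X Y ->
  path (relU h v) a p -> path (relU h v) b p' -> last a p = last b p' ->
  relU h v c d -> c \notin a :: p -> d \notin a :: p ->
  northeast X Y (a :: p) c -> southwest X Y (b :: p') c ->
  northeast X Y (a :: p) d.
Proof.
move=> D ap bp' zE cd cp dp NEc /(southwest_last D bp').
have [//|[vcd]] := northeast_edge D ap cd cp dp NEc.
have zp := mem_last a p; rewrite -zE => Xzc Ydz Xcz.
have /(v_free D vcd) : X c = X (last a p) by apply/le_anti/andP.
rewrite (northeast_last D ap NEc) (ltW Ydz) => /(_ isT).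
rewrite mem_seq2 => /orP[]/eqP z_end; first by rewrite -z_end zp in cp.
by rewrite -z_end zp in dp.
Qed.

Lemma trapped_path h v X Y a p b p' c r : SE_drawing h v X Y ->
  path (relU h v) a p -> path (relU h v) b p' -> last a p = last b p' ->
  path (relU h v) c r ->
  [disjoint c :: r & a :: p] -> [disjoint c :: r & b :: p'] ->
  northeast X Y (a :: p) c -> southwest X Y (b :: p') c ->
  northeast X Y (a :: p) (last c r).
Proof.
move=> D ap bp' zE; elim: r c => [|d r IHr] c //= /andP[cd dr].
rewrite disjoint_cons => /andP[cp drp].
rewrite disjoint_cons => /andP[cp' drp'].
have dp : d \notin a :: p by move: drp; rewrite disjoint_cons => /andP[].
have dp' : d \notin b :: p' by move: drp'; rewrite disjoint_cons => /andP[].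
move=> NEc SWc; apply: IHr => //.
  exact: trapped_edge ap bp' zE cd cp dp NEc SWc.
have sym : relU v h =2 relU h v by move=> s t; apply: orbC.
rewrite -northeast_transpose.
apply: (trapped_edge (drawing_transpose D)) (esym zE) _ cp' dp' _ _.
- by rewrite (eq_path sym).
- by rewrite (eq_path sym).
- by rewrite /= orbC.
- by rewrite northeast_transpose.
- by rewrite southwest_transpose.
Qed.

End Drawing.

(** * SE-graphs *)

Lemma segment_param (R : realFieldType) (a b t : R) :
  a < b -> a <= t <= b -> exists2 c, 0 <= c <= 1 & t = a + c * (b - a).
Proof.
move=> ab /andP[le_at le_tb]; have ba0 : 0 < b - a by rewrite subr_gt0.
exists ((t - a) / (b - a)); last by rewrite divfK ?gt_eqF // addrC subrK.
by rewrite divr_ge0 ?subr_ge0 ?(ltW ab) // ler_pdivrMr // mul1r lerB.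
Qed.

Lemma on_seg_horizontal (a b z : point) :
  a.2 = b.2 -> a.1 < b.1 -> z.2 = a.2 -> a.1 <= z.1 <= b.1 -> on_seg a b z.
Proof.
move=> ab2 ab1 z2 /(segment_param ab1)[c c01 z1]; exists c; split=> //.
by rewrite -ab2 subrr mulr0 addr0 -z1 -z2 -surjective_pairing.
Qed.

Lemma on_seg_vertical (a b z : point) :
  a.1 = b.1 -> b.2 < a.2 -> z.1 = a.1 -> b.2 <= z.2 <= a.2 -> on_seg a b z.
Proof.
rewrite -ltrN2 => ab1 ab2 z1 /andP[bz za].
have [|c c01 z2] := segment_param (t := - z.2) ab2; first by rewrite !lerN2 za.
exists c; split=> //; rewrite -ab1 subrr mulr0 addr0 -z1.
by rewrite [LHS]surjective_pairing -[z.2]opprK z2; congr (_, _); ring.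
Qed.

Section SEgraphs.
Variables (m n : nat) (G : SEgraph m n).
Hypothesis hG : SE_axioms G.
Local Notation edge := (@Defs.edge m n G).
Local Notation px := (fun v : vert G => (pos G v).1).
Local Notation py := (fun v : vert G => (pos G v).2).

Lemma SE_graph_drawing : SE_drawing (hedge G) (vedge G) px py.
Proof.
have hE a b : hedge G a b -> edge a b by rewrite /edge => ->.
have vE a b : vedge G a b -> edge a b by rewrite /edge orbC => ->.
have hr := hedge_geom hG; have vd := vedge_geom hG.
have free a b w : edge a b -> on_seg (pos G a) (pos G b) (pos G w) ->
    w \in [:: a; b].
  by move=> ab /(vertex_off_edges hG ab)[] ->; rewrite mem_seq2 eqxx ?orbT.
split=> // [u w Xuw Yuw|a b w ab Yaw Xw|a b w ab Xaw Yw|a b s t ab st Xs Ya].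
- apply: (pos_inj hG).
  by rewrite [pos G u]surjective_pairing Xuw Yuw -surjective_pairing.
- have [Yab Xab] := hr _ _ ab.
  by apply: free (hE _ _ ab) _; apply: on_seg_horizontal.
- have [Xab Yab] := vd _ _ ab.
  by apply: free (vE _ _ ab) _; apply: on_seg_vertical.
have [[Yab Xab] [Xst Yst]] := (hr _ _ ab, vd _ _ st).
have ab_st : (a, b) <> (s, t).
  by move=> [sE tE]; rewrite sE tE Xst ltxx in Xab.
have on_ab : on_seg (pos G a) (pos G b) (px s, py a).
  exact: on_seg_horizontal.
have on_st : on_seg (pos G s) (pos G t) (px s, py a).
  exact: on_seg_vertical.
have [w [wab [wst _]]] :=
  edges_noncross hG (hE _ _ ab) (vE _ _ st) ab_st on_ab on_st.
by exists w; rewrite mem_seq2; [case: wab|case: wst] => ->; rewrite eqxx ?orbT.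
Qed.

Local Notation drawing := SE_graph_drawing.

Definition rank (v : vert G) : Rdefinitions.R := (pos G v).1 - (pos G v).2.

Lemma edge_rank : {homo rank : u v / edge u v >-> u < v}.
Proof. exact: edge_SE_rank drawing. Qed.

Lemma is_src_src i : is_src (src G i).
Proof. by apply/existsP; exists i. Qed.

Lemma is_snk_snk j : is_snk (snk G j).
Proof. by apply/existsP; exists j. Qed.

Lemma src_inj : injective (src G).
Proof.
move=> i i' ii'; apply: ord_inj.
by case: (ltngtP i i') => // /(src_up hG); rewrite ii' ltxx.
Qed.

Lemma snk_inj : injective (snk G).
Proof.
move=> j j' jj'; apply: ord_inj.
by case: (ltngtP j j') => // /(snk_right hG); rewrite jj' ltxx.
Qed.

Lemma edge_tail_not_snk u v : edge u v -> ~~ is_snk u.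
Proof.
move=> uv; apply/existsP => -[j /eqP uE].
by move: uv; rewrite -uE (negbTE (snk_no_out hG _ _)).
Qed.

Lemma edge_head_not_src u v : edge u v -> ~~ is_src v.
Proof.
move=> uv; apply/existsP => -[i /eqP vE].
by move: uv; rewrite -vE (negbTE (src_no_in hG _ _)).
Qed.

Lemma hedge_head_inner u v : hedge G u v -> inner v.
Proof.
move=> uv; rewrite /inner (@edge_head_not_src u) ?/edge ?uv //=.
apply/existsP => -[j /eqP vE]; have /andP[_] := snk_only_v hG j u.
by rewrite vE uv.
Qed.

Lemma edge_src_hedge u v : edge u v -> is_src u -> hedge G u v.
Proof.
case/orP=> // uv /existsP[i /eqP uE].
by have /andP[] := src_only_h hG i v; rewrite uE uv.
Qed.

Lemma edge_snk_vedge u v : edge u v -> is_snk v -> vedge G u v.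
Proof.
by case/orP=> // /hedge_head_inner/andP[_ /negP vs] /vs.
Qed.

Lemma hedge_tail_inner u v : hedge G u v -> ~~ is_src u -> inner u.
Proof.
by move=> uv us; rewrite /inner us (@edge_tail_not_snk u v) // /edge uv.
Qed.

Lemma path_not_src a p v : path edge a p -> v \in p -> ~~ is_src v.
Proof. by move=> ap /(path_pred ap)[u _]; apply: edge_head_not_src. Qed.

Lemma path_snk a p j :
  path edge a p -> snk G j \in a :: p -> last a p = snk G j.
Proof.
elim: p a => [|b p IHp] a /=; first by rewrite inE => _ /eqP ->.
case/andP=> ab bp; rewrite in_cons => /predU1P[jE|/(IHp _ bp)//].
by have := edge_tail_not_snk ab; rewrite -jE is_snk_snk.
Qed.

Lemma snk_lowest v j : (pos G (snk G j)).2 <= (pos G v).2 ?= iff is_snk v.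
Proof.
have [i [j' [_ /connectP[p vp jE]]]] := on_src_snk_path hG v.
rewrite (snk_line hG j j').
case: (lastP p) vp jE => [_ /= <-|{}p c].
  by rewrite is_snk_snk; split; rewrite ?eqxx.
rewrite rcons_path last_rcons => /andP[vp pc] cE; subst c.
have [_ Yv] := connect_SE drawing (path_connect_last vp (mem_head _ _)).
have [_ Yj'] := vedge_geom hG (edge_snk_vedge pc (is_snk_snk j')).
have lt_v := lt_le_trans Yj' Yv; split; first exact: ltW.
rewrite lt_eqF //; apply/esym/existsP => -[j0 /eqP vE].
by rewrite -vE (snk_line hG j' j0) ltxx in lt_v.
Qed.

Lemma disjoint_paths_order a p b p' j j' :
  path edge a p -> path edge b p' ->
  last a p = snk G j -> last b p' = snk G j' ->
  [disjoint b :: p' & a :: p] ->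
  northeast px py (a :: p) b -> (j < j')%N.
Proof.
move=> ap bp' pj p'j' disj NEb.
have same_level : py (last a p) = py (last b p').
  by rewrite pj p'j' (snk_line hG j j').
have /hasP[v vp] : northeast px py (a :: p) (snk G j').
  rewrite -p'j'; apply: (northeast_path drawing ap bp' disj _ NEb).
  by rewrite same_level.
case/andP=> Xv Yv; have [_] := snk_lowest v j'.
rewrite eq_le Yv (leif_le (snk_lowest _ _)) => /esym/existsP[i /eqP vE].
have iE : snk G i = snk G j by rewrite -pj -(path_snk ap) ?vE.
rewrite ltn_neqAle; apply/andP; split.
  apply: contraTN disj => /eqP/ord_inj jj'; rewrite disjoint_has negbK.
  apply/hasP; exists (snk G j'); first by rewrite -p'j' mem_last.
  by rewrite /= -jj' -pj mem_last.
by rewrite leqNgt; apply/negP => /(snk_right hG); rewrite ltNge -iE vE Xv.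
Qed.

Lemma meet_not_snk a p b p' j j' z : path edge a p -> path edge b p' ->
  last a p = snk G j -> last b p' = snk G j' -> j != j' ->
  z \in p -> z \in p' -> ~~ is_snk z.
Proof.
move=> ap bp' pj p'j' jj' zp zp'; apply: contra jj' => /existsP[i /eqP zE].
rewrite -{z}zE in zp zp' *; apply/eqP/snk_inj; rewrite -pj -p'j'.
rewrite (path_snk (j := i) ap) ?inE ?zp ?orbT //.
by rewrite (path_snk (j := i) bp') ?inE ?zp' ?orbT.
Qed.

Lemma fork_directions z b P c Q j j' :
  path edge z (b :: P) -> path edge z (c :: Q) -> [disjoint b :: P & c :: Q] ->
  last b P = snk G j -> last c Q = snk G j' -> (j < j')%N ->
  vedge G z b /\ hedge G z c.
Proof.
move=> zbP zcQ disj bj cj' jj'.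
have /andP[zb bP] := zbP; have /andP[zc cQ] := zcQ.
have bc : b <> c by move=> bc; move: disj; rewrite disjoint_has bc /= mem_head.
have vzb : vedge G z b.
  case/orP: zb => // hzb.
  have zbP' : z \notin b :: P by have /andP[] := path_uniq edge_rank zbP.
  have /(disjoint_paths_order zcQ bP cj' bj) : [disjoint b :: P & z :: c :: Q].
    by rewrite disjoint_sym disjoint_cons zbP' disjoint_sym.
  have [/= Yzb /ltW Xzb] := h_right drawing hzb.
  rewrite /northeast /= Yzb Xzb lexx => /(_ isT).
  by rewrite ltnNge ltnW.
by split=> //; case/orP: zc => // /(v_out_inj drawing vzb)/bc.
Qed.

End SEgraphs.

(** * Commutation of path weights *)

Section PathWeights.
Variables (m n : nat) (G : SEgraph m n).
Hypothesis hG : SE_axioms G.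
Local Notation V := (vert G).
Local Notation edge := (@Defs.edge m n G).
Variables (K : fieldType) (q : K) (A : unitAlgType K) (x : V -> A).
Hypotheses (hq : q != 0) (hx : qtorus_rel q x).
Local Notation drawing := (SE_graph_drawing hG).
Local Notation hreach := (reach (hedge G)).
Local Notation vreach := (reach (vedge G)).

Lemma pw_nil a : pw x a [::] = 1.
Proof. exact: big_nil. Qed.

Lemma pw_cons a b p : pw x a (b :: p) = ew x a b * pw x b p.
Proof. exact: big_cons. Qed.

Lemma pw_cat a p p' : pw x a (p ++ p') = pw x a p * pw x (last a p) p'.
Proof.
elim: p a => [|b p IHp] a /=; first by rewrite pw_nil mul1r.
by rewrite !pw_cons IHp mulrA.
Qed.

Lemma qcomm_inner u v : inner u -> inner v ->
  qcomm q (hreach u v - vreach u v) (x u) (x v).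
Proof.
move=> iu iv; have [->|uv] := eqVneq u v.
  by rewrite !reachxx /qcomm subrr expr0z scale1r.
have xh s t : inner s -> inner t -> s != t -> connect (hedge G) s t ->
    qcomm q (hreach s t - vreach s t) (x s) (x t).
  rewrite /qcomm => inner_s inner_t st hst.
  have [-> //] := hx.2 s t inner_s inner_t st.
  have := connect_h_exclusive drawing st hst; rewrite /reach hst.
  by move=> [/negbTE-> /negbTE-> /negbTE->].
have xv s t : inner s -> inner t -> s != t -> connect (vedge G) s t ->
    qcomm q (hreach t s - vreach t s) (x t) (x s).
  rewrite /qcomm => inner_s inner_t st vst.
  have [_ [-> // _]] := hx.2 s t inner_s inner_t st.
  have := connect_v_exclusive drawing st vst; rewrite /reach vst.
  by move=> [/negbTE-> /negbTE-> /negbTE->].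
have swap : - (hreach v u - vreach v u) = hreach u v - vreach u v.
  by rewrite (reach_antisym _ u v) (reach_antisym _ u v) -opprD opprK.
have vu : v != u by rewrite eq_sym.
have [huv|nhuv] := boolP (connect (hedge G) u v); first exact: xh.
have [hvu|nhvu] := boolP (connect (hedge G) v u).
  by rewrite -swap; apply/qcomm_sym/xh.
have [vuv|nvuv] := boolP (connect (vedge G) u v).
  by rewrite -swap; apply/qcomm_sym/xv.
have [vvu|nvvu] := boolP (connect (vedge G) v u); first exact: xv.
have [_ [_ commute]] := hx.2 u v iu iv uv.
rewrite /reach (negbTE nhuv) (negbTE nhvu) (negbTE nvuv) (negbTE nvvu).
by rewrite /qcomm commute // scale1r.
Qed.

Lemma variation_hv f a p : path edge a p ->
  variation (hedge G) f a p = f (last a p) - f a - variation (vedge G) f a p.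
Proof.
elim: p a => [|b p IHp] a; first by rewrite !variation_nil !subrr.
case/andP=> ab /IHp{}IHp; rewrite !variation_cons IHp /=.
have [hab|nhab] := boolP (hedge G a b).
  by rewrite (h_edge_not_v drawing hab); ring.
by move: ab; rewrite /edge (negbTE nhab) /= => ->; ring.
Qed.

Lemma qcomm_edge_vertex u v w : edge u v -> ~~ is_src u -> inner w ->
  qcomm q (vreach u w - vreach v w - ((w == u)%:Z + (w == v)%:Z))
    (ew x u v) (x w).
Proof.
move=> uv us iw; rewrite /ew (negbTE us).
have [huv|nhuv] := boolP (hedge G u v).
  have iu := hedge_tail_inner hG huv us; have iv := hedge_head_inner hG huv.
  have xuV := qcommVl hq (hx.1 _ iu) (qcomm_inner iu iw).
  have := qcommMl hq xuV (qcomm_inner iv iw); congr (qcomm _ _ _ _).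
  rewrite -(reach_edge (h_lines drawing) _ huv).
  by rewrite (reach_antisym _ w v) (reach_antisym _ w u); ring.
have vuv : vedge G u v by move: uv; rewrite /edge (negbTE nhuv).
have := qcomm1l q (x w); congr (qcomm _ _ _ _).
rewrite -(reach_edge (v_lines drawing) _ vuv).
by rewrite (reach_antisym _ w v) (reach_antisym _ w u); ring.
Qed.

Lemma qcomm_path_vertex a p w : path edge a p -> ~~ is_src a -> inner w ->
  qcomm q (vreach a w - vreach (last a p) w - path_degree a p w)
    (pw x a p) (x w).
Proof.
move=> + + iw; elim: p a => [|b p IHp] a /=.
  by rewrite pw_nil subrr => _ _; apply: qcomm1l.
case/andP=> ab bp nsrc_a; rewrite pw_cons path_degree_cons.
have xb := IHp b bp (edge_head_not_src hG ab).
have := qcommMl hq (qcomm_edge_vertex ab nsrc_a iw) xb.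
by congr (qcomm _ _ _ _); ring.
Qed.

Lemma qcomm_src_path_vertex a p w : path edge a p -> is_src a -> p != [::] ->
  inner w ->
  qcomm q (hreach a w - vreach (last a p) w - path_degree a p w)
    (pw x a p) (x w).
Proof.
case: p => // b p /= /andP[ab bp] src_a _ iw.
have hab := edge_src_hedge hG ab src_a; rewrite pw_cons /ew hab src_a.
have xb := qcomm_inner (hedge_head_inner hG hab) iw.
have xp := qcomm_path_vertex bp (edge_head_not_src hG ab) iw.
have := qcommMl hq xb xp; congr (qcomm _ _ _ _).
rewrite path_degree_cons -(reach_edge (h_lines drawing) _ hab).
by rewrite (reach_antisym _ b w) (reach_antisym _ a w); ring.
Qed.

Lemma qcomm_path (f : V -> int) y a p : path edge a p -> ~~ is_src a ->
  (forall w, inner w -> qcomm q (f w) y (x w)) ->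
  qcomm q (variation (hedge G) f a p) y (pw x a p).
Proof.
move=> + + yx; elim: p a => [|b p IHp] a.
  by rewrite pw_nil variation_nil => _ _; apply: qcomm1r.
case/andP=> ab bp nsrc_a; rewrite pw_cons variation_cons.
apply: qcommMr => //; last exact: IHp bp (edge_head_not_src hG ab).
rewrite /ew (negbTE nsrc_a); case: ifP => [hab|_]; last exact: qcomm1r.
have ia := hedge_tail_inner hG hab nsrc_a; have ib := hedge_head_inner hG hab.
have yaV := qcommVr hq (hx.1 a ia) (yx a ia).
by rewrite addrC; apply: qcommMr yaV (yx b ib).
Qed.

Lemma edge_hv_sum u v : edge u v -> (hedge G u v)%:Z + (vedge G u v)%:Z = 1.
Proof.
case/orP=> uv; rewrite uv; first by rewrite (h_edge_not_v drawing uv).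
by have [/(h_edge_not_v drawing)|_] := boolP (hedge G u v); rewrite ?uv.
Qed.

Lemma vreach0 u v : (pos G u).1 < (pos G v).1 -> vreach u v = 0.
Proof.
move=> uv; have uv0 : connect (vedge G) u v = false.
  by apply: contraTF uv => /(connect_v_down drawing)[-> _]; rewrite ltxx.
have vu0 : connect (vedge G) v u = false.
  by apply: contraTF uv => /(connect_v_down drawing)[-> _]; rewrite ltxx.
by rewrite /reach uv0 vu0.
Qed.

Lemma qcomm_src_path_tail a z b p p' : path edge a (rcons p z ++ b :: p') ->
  is_src a ->
  qcomm q (1 - vreach z (last b p')) (pw x a (rcons p z)) (pw x z (b :: p')).
Proof.
move=> zp' src_a; have := path_uniq (edge_rank hG) zp'.
rewrite -cat_cons cat_uniq => /and3P[uniq_p /hasPn off _].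
have zs : ~~ is_src z.
  by apply: (path_not_src hG zp'); rewrite mem_cat mem_rcons mem_head.
move: zp'; rewrite cat_path last_rcons => /andP[zp bp'].
have p0 : rcons p z != [::] by case: (p).
have az : a \notin z :: b :: p'.
  rewrite inE negb_or; apply/andP; split; first by apply: contraNneq zs => <-.
  by apply: contraTN src_a => ap'; have := off a ap'; rewrite mem_head.
have zb : z \notin b :: p'.
  by apply/negP => /off; rewrite inE mem_rcons mem_head orbT.
have := qcomm_path bp' zs (fun w => qcomm_src_path_vertex zp src_a p0).
congr (qcomm _ _ _ _).
rewrite last_rcons 2!variationB.
rewrite (variation_reach_notin (h_lines drawing) az) sub0r variation_hv //.
rewrite (variation_reach_head (v_lines drawing) zb) reachxx.
rewrite variation_head => [|w /off wp]; last exact: path_degree_notin.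
have /andP[/edge_hv_sum <- _] := bp'.
by rewrite (path_degree_last uniq_p) mulr1 /=; ring.
Qed.

Lemma qcomm_path_fork z b p c p' :
  path edge z (b :: p) -> path edge z (c :: p') -> ~~ is_src z ->
  [disjoint b :: p & c :: p'] ->
  qcomm q (vreach z (last c p') - (vedge G z c)%:Z
           - (vreach (last b p) (last c p') - vreach (last b p) z)
           + (hedge G z c)%:Z)
    (pw x z (b :: p)) (pw x z (c :: p')).
Proof.
move=> zb zc zs; rewrite disjoint_sym disjoint_has => /hasPn off.
have /andP[zb' _] := path_uniq (edge_rank hG) zb.
have /andP[zc' _] := path_uniq (edge_rank hG) zc.
have tc : last b p \notin z :: c :: p'.
  rewrite inE negb_or; apply/andP; split.
    by apply: contraNneq zb' => <-; apply: mem_last.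
  by apply/negP => /off; rewrite mem_last.
have := qcomm_path zc zs (fun w => qcomm_path_vertex zb zs).
congr (qcomm _ _ _ _).
rewrite 2!variationB (variation_hv (vreach z)) //.
rewrite (variation_hv (vreach (last b p))) //.
rewrite (variation_reach_head (v_lines drawing) zc').
rewrite (variation_reach_notin (v_lines drawing) tc).
rewrite variation_head => [|w wc]; last first.
  rewrite path_degree_notin // inE negb_or off // andbT.
  by apply: contraNneq zc' => <-.
by rewrite path_degree_head // reachxx /=; ring.
Qed.

Lemma pw_fork_exchange a z p b P c Q j j' : is_src a ->
  path edge a (rcons p z ++ b :: P) -> path edge a (rcons p z ++ c :: Q) ->
  vedge G z b -> hedge G z c -> [disjoint b :: P & c :: Q] ->
  last b P = snk G j -> last c Q = snk G j' -> (j < j')%N ->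
  pw x z (b :: P) * pw x a (rcons p z) * pw x z (c :: Q) =
  q *: (pw x z (c :: Q) * pw x a (rcons p z) * pw x z (b :: P)).
Proof.
move=> src_a apb apc zb zc disj bj cj' jj'.
have zs : ~~ is_src z.
  by apply: (path_not_src hG apb); rewrite mem_cat mem_rcons mem_head.
move: (apb) (apc); rewrite !cat_path last_rcons => /andP[_ zbP] /andP[_ zcQ].
have zj' : vreach z (snk G j') = 0.
  apply: vreach0; have [_ /lt_le_trans->//] := h_right drawing zc.
  rewrite -cj'; have /andP[_ cQ] := zcQ.
  by have [] := connect_SE drawing (path_connect_last cQ (mem_head _ _)).
have jj'0 : vreach (snk G j) (snk G j') = 0 by apply/vreach0/(snk_right hG).
have zc_not_v : vedge G z c = false by apply: h_edge_not_v drawing _ _ zc.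
have stem_b := qcomm_sym hq (qcomm_src_path_tail apb src_a).
have stem_c := qcomm_src_path_tail apc src_a.
rewrite (qcomm_rev3 hq stem_b (qcomm_path_fork zbP zcQ zs disj) stem_c).
rewrite bj cj' zj' jj'0 zc zc_not_v (reach_antisym _ z (snk G j)).
by rewrite (_ : _ + _ + _ = 1) ?expr1z //=; ring.
Qed.

Lemma pw_exchange_tails a b p p' j j' w : is_src b ->
  path edge a p -> path edge b p' ->
  last a p = snk G j -> last b p' = snk G j' -> (j < j')%N ->
  w \in p -> w \in p' ->
  pw x a p * pw x b p' =
  q *: (pw x a (exchange_tails (@rank m n G) p p') *
        pw x b (exchange_tails (@rank m n G) p' p)).
Proof.
move=> bs ap bp' pj p'j' jj' wp wp'.
case: (meetingP (edge_rank hG) ap bp' wp wp') pj p'j' => {ap bp' wp wp'}.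
move=> z p1 p2 p1' p2' ap bp' disj _ pj p'j'.
have disj' : [disjoint p2' & p2] by rewrite disjoint_sym.
rewrite (exchange_tailsE (edge_rank hG) ap bp' disj).
rewrite (exchange_tailsE (edge_rank hG) bp' ap disj').
have zs : ~~ is_snk z.
  apply: (meet_not_snk hG ap bp' pj p'j'); first by rewrite neq_ltn jj'.
    by rewrite mem_cat mem_rcons mem_head.
  by rewrite mem_cat mem_rcons mem_head.
have bp2 : path edge b (rcons p1' z ++ p2) by apply: path_exchange_cat bp' ap.
rewrite !pw_cat !last_rcons; move: pj p'j' {ap}; rewrite !last_cat !last_rcons.
case: p2 disj {disj'} bp2 => [|c P] disj bp2.
  by move=> /= zE; rewrite zE is_snk_snk in zs.
case: p2' disj bp' => [|d Q] disj bp'.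
  by move=> /= _ zE; rewrite zE is_snk_snk in zs.
move=> Pj Qj'; move: (bp2) (bp'); rewrite !cat_path !last_rcons.
move=> /andP[_ zP] /andP[_ zQ].
have [vzc hzd] := fork_directions hG zP zQ disj Pj Qj' jj'.
have := pw_fork_exchange bs bp2 bp' vzc hzd disj Pj Qj' jj'.
by rewrite -!mulrA => ->; rewrite -scalerAr.
Qed.

End PathWeights.

(** * The sign-reversing involution *)

Section Involution.
Variables (m n : nat) (G : SEgraph m n).
Hypothesis hG : SE_axioms G.
Local Notation V := (vert G).
Local Notation edge := (@Defs.edge m n G).
Local Notation px := (fun v : V => (pos G v).1).
Local Notation py := (fun v : V => (pos G v).2).
Local Notation rank := (@rank m n G).
Local Notation rank_homo := (edge_rank hG).
Local Notation drawing := (SE_graph_drawing hG).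

Lemma pseq_inj : injective (@pseq m n G).
Proof.
move=> [l t] [l' t'] tE.
have ll' : l = l'.
  by apply: val_inj; rewrite /= -(size_tuple t) -(size_tuple t'); congr size.
by subst l'; congr existT; apply: val_inj.
Qed.

Definition ptype_of_seq (p0 : ptype G) (r : seq V) : ptype G :=
  odflt p0 [pick p | pseq p == r].

Lemma ptype_of_seqK p0 r : (size r < #|V|)%N -> pseq (ptype_of_seq p0 r) = r.
Proof.
move=> lt_r; rewrite /ptype_of_seq; case: pickP => [p /eqP//|no_p].
by have := no_p (Tagged _ (in_tuple r : (Ordinal lt_r).-tuple V)); rewrite eqxx.
Qed.

Variables (k : nat) (I : {set 'I_m}) (J : {set 'I_n}).
Variables (hI : #|I| = k) (hJ : #|J| = k).
Local Notation family := {ffun 'I_k -> ptype G}.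
Local Notation s l := (src G (elt hI l)).
Local Notation t l := (snk G (elt hJ l)).
Implicit Types (F : family) (sg tau : 'S_k) (l : 'I_k) (v w z : V).
Local Notation route F l := (pseq (F l)).

Definition joins sg F := [forall l, is_path (s l) (t (sg l)) (route F l)].

Lemma joinsP sg F l : joins sg F ->
  path edge (s l) (route F l) /\ last (s l) (route F l) = t (sg l).
Proof. by move/forallP/(_ l)/andP=> [? /eqP]. Qed.

Definition load F v : nat := #|[set l | v \in route F l]|.

Definition shared F v : bool := (1 < load F v)%N.

Definition noncrossing F : bool := [forall v, ~~ shared F v].

Lemma sharedP F v :
  reflect (exists l l', [/\ l != l', v \in route F l & v \in route F l'])
          (shared F v).
Proof.
apply: (iffP card_gt1P) => -[l [l' [vl vl' ll']]]; exists l, l'.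
  by rewrite !inE in vl vl'.
by rewrite !inE.
Qed.

Lemma load_count sg F v : joins sg F ->
  load F v = (\sum_l count_mem v (route F l))%N.
Proof.
move=> jF; rewrite /load -sum1dep_card big_mkcond; apply: eq_bigr => l _.
have [/(path_uniq rank_homo)/andP[_ uniq_l] _] := joinsP l jF.
by rewrite count_uniq_mem //; case: (_ \in _).
Qed.

Lemma common_in_routes sg F l l' v : joins sg F -> l != l' ->
  v \in s l :: route F l -> v \in s l' :: route F l' ->
  (v \in route F l) && (v \in route F l').
Proof.
move=> jF ll'; have [pl _] := joinsP l jF; have [pl' _] := joinsP l' jF.
rewrite !inE => /predU1P[->|vl] /predU1P[|vl']; last by rewrite vl.
- by move/(src_inj hG)/elt_inj => lE; rewrite lE eqxx in ll'.
- by have := path_not_src hG pl' vl'; rewrite is_src_src.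
- by move=> vE; have := path_not_src hG pl vl; rewrite vE is_src_src.
Qed.

Lemma noncrossing_disjoint sg F l l' : joins sg F -> noncrossing F -> l != l' ->
  [disjoint s l :: route F l & s l' :: route F l'].
Proof.
move=> jF ncF ll'; rewrite disjoint_has; apply/hasPn => v vl; apply/negP => vl'.
have /andP[vr vr'] := common_in_routes jF ll' vl vl'.
by move/forallP/(_ v)/sharedP: ncF; case; exists l, l'.
Qed.

Lemma src_le l l' : (l <= l')%N -> py (s l) <= py (s l').
Proof.
rewrite leq_eqVlt => /predU1P[/val_inj->//|ll'].
exact/ltW/(src_up hG)/elt_lt.
Qed.

Lemma northeast_src l l' r : (l <= l')%N -> northeast px py (s l :: r) (s l').
Proof.
move=> /src_le Yll'; rewrite /northeast /= Yll'.
by rewrite (src_line hG (elt hI l) (elt hI l')) lexx.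
Qed.

Lemma southwest_src l l' r : (l <= l')%N -> southwest px py (s l' :: r) (s l).
Proof.
move=> /src_le Yll'; rewrite /southwest /= Yll'.
by rewrite (src_line hG (elt hI l) (elt hI l')) lexx.
Qed.

Lemma joins_noncrossing_id sg F : joins sg F -> noncrossing F -> sg = 1%g.
Proof.
move=> jF ncF; apply: perm_increasing => l l' ll'; rewrite -(elt_lt_mono hJ).
have [pl el] := joinsP l jF; have [pl' el'] := joinsP l' jF.
apply: (disjoint_paths_order hG pl pl' el el'); last exact/northeast_src/ltnW.
by apply: noncrossing_disjoint jF ncF _; rewrite neq_ltn ll' orbT.
Qed.

Lemma is_flowE F : is_flow hI hJ F = joins 1 F && noncrossing F.
Proof.
apply/andP/andP => [[ends disj]|[jF ncF]]; last first.
  split; apply/forallP => l.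
    apply/exists_inP; exists (elt hJ l); first exact: elt_in.
    by move/forallP/(_ l): jF; rewrite perm1.
  by apply/forallP => l'; apply/implyP; apply: noncrossing_disjoint jF ncF.
have disjE l l' : l != l' -> [disjoint s l :: route F l & s l' :: route F l'].
  by move=> ll'; move/forallP/(_ l)/forallP/(_ l')/implyP: disj; apply.
have ncF : noncrossing F.
  apply/forallP => v; apply/sharedP => -[l [l' [ll' vl vl']]].
  have /pred0P/(_ v) := disjE l l' ll'.
  by rewrite /= !inE vl vl' !orbT.
have endP l : exists l', is_path (s l) (t l') (route F l).
  move/forallP/(_ l)/exists_inP: ends => [j /(elt_onto hJ)[l' ->]].
  by exists l'.
have {endP} [target targetP] := fin_all_exists endP.
have target_inj : injective target.
  move=> l l' ll'; apply: contraTeq isT => /disjE.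
  rewrite disjoint_has => /hasPn/(_ (t (target l))).
  have [/andP[_ /eqP el] /andP[_ /eqP el']] := (targetP l, targetP l').
  by rewrite -{1}el mem_last ll' -el' mem_last => /(_ isT).
have jF : joins (perm target_inj) F by apply/forallP => l; rewrite permE.
by rewrite -(joins_noncrossing_id jF ncF).
Qed.

(* A route that is its own partner under [tau] stays fixed. *)
Definition exchange_routes tau F : family :=
  [ffun l => ptype_of_seq (F l)
               (exchange_tails rank (route F l) (route F (tau l)))].

Section ExchangeRoutes.
Variables (sg tau : 'S_k) (F : family) (z : V).
Hypotheses (jF : joins sg F) (tauK : involutive tau).
Hypothesis zF : forall l, tau l != l -> z \in route F l.

Lemma partners_meet l : tau l != l ->
  [/\ path edge (s l) (route F l), path edge (s (tau l)) (route F (tau l)),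
      z \in route F l & z \in route F (tau l)].
Proof.
move=> tl; have [pl _] := joinsP l jF; have [ptl _] := joinsP (tau l) jF.
by split=> //; apply: zF; rewrite // tauK eq_sym.
Qed.

Lemma exchange_route_ends l :
  let r := exchange_tails rank (route F l) (route F (tau l)) in
  path edge (s l) r /\ last (s l) r = t (sg (tau l)).
Proof.
have [_ etl] := joinsP (tau l) jF.
have [tl|/partners_meet[pl ptl zl ztl]] := eqVneq (tau l) l.
  by rewrite tl exchange_tails_id; apply: joinsP.
split; first exact: (path_exchange_tails rank_homo pl ptl zl ztl).
by rewrite (last_exchange_tails rank_homo pl ptl zl ztl).
Qed.

Lemma exchange_routesE l :
  route (exchange_routes tau F) l =
  exchange_tails rank (route F l) (route F (tau l)).
Proof.
rewrite ffunE ptype_of_seqK //; have [pl _] := exchange_route_ends l.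
exact: (path_size rank_homo pl).
Qed.

Lemma joins_exchange_routes : joins (tau * sg) (exchange_routes tau F).
Proof.
apply/forallP => l; rewrite /is_path exchange_routesE permM.
by have [-> ->] := exchange_route_ends l; rewrite eqxx.
Qed.

Lemma mem_exchange_routes v l : rank v <= rank z ->
  (v \in route (exchange_routes tau F) l) = (v \in route F l).
Proof.
move=> vz; rewrite exchange_routesE.
have [->|/partners_meet[pl ptl zl ztl]] := eqVneq (tau l) l.
  by rewrite exchange_tails_id.
exact: (mem_exchange_tails rank_homo pl ptl zl ztl).
Qed.

Lemma load_exchange_routes : load (exchange_routes tau F) =1 load F.
Proof.
move=> v; rewrite (load_count _ jF) (load_count _ joins_exchange_routes).
have doubled (f : 'I_k -> nat) :
    (\sum_l f l).*2 = (\sum_l (f l + f (tau l)))%N.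
  by rewrite -addnn {2}(reindex_inj (@perm_inj _ tau)) -big_split.
apply: double_inj; rewrite !doubled; apply: eq_bigr => l _.
rewrite !exchange_routesE tauK.
have [->|/partners_meet[pl ptl zl ztl]] := eqVneq (tau l) l.
  by rewrite exchange_tails_id.
exact: (count_exchange_tails rank_homo pl ptl zl ztl).
Qed.

Lemma exchange_routesK : exchange_routes tau (exchange_routes tau F) = F.
Proof.
apply/ffunP => l; apply: pseq_inj; rewrite ffunE !exchange_routesE tauK.
have [pl _] := joinsP l jF; set r := exchange_tails _ _ _.
suff -> : r = route F l by apply: ptype_of_seqK (path_size rank_homo pl).
rewrite {}/r; have [->|/partners_meet[{}pl ptl zl ztl]] := eqVneq (tau l) l.
  by rewrite !exchange_tails_id.
exact: (exchange_tailsK rank_homo pl ptl zl ztl).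
Qed.

End ExchangeRoutes.

Definition first_shared F z : bool :=
  shared F z && [forall v, shared F v ==> (rank z <= rank v)].

Lemma exists_first_shared F : ~~ noncrossing F -> exists z, first_shared F z.
Proof.
case/forallPn=> v; rewrite negbK => shared_v.
case: (arg_minP (P := shared F) rank shared_v) => z shared_z zmin.
by exists z; apply/andP; split=> //; apply/forallP => w; apply/implyP/zmin.
Qed.

Section FirstShared.
Variables (sg : 'S_k) (F : family) (z : V).
Hypotheses (jF : joins sg F) (fz : first_shared F z).

Lemma common_before_first_shared l l' v : rank v < rank z ->
  v \in s l :: route F l -> v \in s l' :: route F l' -> l = l'.
Proof.
move=> vz vl vl'; apply/eqP; apply: contraTT vz => ll'; rewrite -leNgt.
have /andP[vr vr'] := common_in_routes jF ll' vl vl'.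
have /andP[_ /forallP/(_ v)/implyP] := fz; apply.
by apply/sharedP; exists l, l'.
Qed.

(* The routes through [z] enter it by distinct edges, and at most two edges,
   one horizontal and one vertical, end at [z]. *)
Lemma load_first_shared : (load F z <= 2)%N.
Proof.
pose by_hedge l := [exists u, (u \in s l :: route F l) && hedge G u z].
rewrite -card_bool; apply: (leq_card_in by_hedge) => l l'.
rewrite !inE => zl zl'.
have entering l0 : z \in route F l0 -> exists u,
    [/\ u \in s l0 :: route F l0, edge u z & by_hedge l0 = hedge G u z].
  move=> zl0; have [p0 _] := joinsP l0 jF; have [u ul0 uz] := path_pred p0 zl0.
  case: (boolP (by_hedge l0)) => [/existsP[w /andP[wl0 wz]]|/existsPn/(_ u)].
    by exists w; rewrite /edge wz.
  by rewrite ul0 => /negbTE; exists u.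
have [[u [ul uz ->]] [u' [ul' uz' ->]]] := (entering l zl, entering l' zl').
move=> same_kind; suff uu' : u = u'.
  rewrite -uu' in ul'.
  exact: common_before_first_shared (edge_rank hG uz) ul ul'.
case/orP: uz => uz; first by apply: (h_in_inj drawing uz); rewrite -same_kind.
apply: (v_in_inj drawing uz); case/orP: uz' => // uz'.
by have := h_edge_not_v drawing (etrans same_kind uz'); rewrite uz.
Qed.

Lemma first_shared_cut l : z \in route F l ->
  exists p, path edge (s l) (rcons p z) /\
    forall c, z \notin route F c ->
      [disjoint s c :: route F c & s l :: rcons p z].
Proof.
move=> zl; have [pl _] := joinsP l jF.
have [p [p' rE]] : exists p p', route F l = rcons p z ++ p'.
  by case/path.splitP: zl => p p'; exists p, p'.
move: (pl); rewrite rE cat_path => /andP[pz _]; exists p; split=> // c zc.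
rewrite disjoint_has; apply/hasPn => v vc; apply/negP.
have lc : l != c by apply: contraNneq zc => <-.
rewrite -rcons_cons mem_rcons inE.
case/predU1P=> [vz|vp].
  have := common_in_routes jF lc _ vc; rewrite vz inE zl orbT => /(_ isT).
  by rewrite (negbTE zc) andbF.
case/eqP: lc; apply: (common_before_first_shared _ _ vc).
  by rewrite -cats1 in pz; apply: (path_cat_rank rank_homo pz vp); rewrite inE.
by rewrite rE -cat_cons mem_cat -rcons_cons mem_rcons inE vp orbT.
Qed.

(* A route starting between the two would be caught between them until it
   passed [z], and could not reach its sink, which lies below [z]. *)
Lemma first_shared_adjacent (a b : 'I_k) : (a < b)%N ->
  z \in route F a -> z \in route F b -> b = a.+1 :> nat.
Proof.
move=> ab za zb; apply/eqP; rewrite eqn_leq ab andbT leqNgt; apply/negP => lt_b.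
pose c := Ordinal (leq_ltn_trans (ltnW lt_b) (ltn_ord b)).
have zc : z \notin route F c.
  apply: contraTN load_first_shared => zc; rewrite -ltnNge; apply/card_gt2P.
  exists a, b, c; rewrite !inE za zb zc -!val_eqE /= (ltn_eqF ab).
  by rewrite (gtn_eqF lt_b) (gtn_eqF (ltnSn a)).
have [pa ea] := joinsP a jF; have [pb eb] := joinsP b jF.
have [pc ec] := joinsP c jF.
have ends_differ : elt hJ (sg a) != elt hJ (sg b).
  by rewrite (inj_eq (@elt_inj _ _ _ hJ)) (inj_eq perm_inj) neq_ltn ab.
have zs := meet_not_snk hG pa pb ea eb ends_differ za zb.
have [p [pz disj_p]] := first_shared_cut za.
have [p' [pz' disj_p']] := first_shared_cut zb.
have same_end : last (s a) (rcons p z) = last (s b) (rcons p' z).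
  by rewrite !last_rcons.
have NEc := northeast_src (rcons p z) (leqnSn a : (a <= c)%N).
have SWc := southwest_src (rcons p' z) (ltnW lt_b : (c <= b)%N).
have [Rp Rp'] := (disj_p c zc, disj_p' c zc).
have := trapped_path drawing pz pz' same_end pc Rp Rp' NEc SWc.
move/(northeast_last drawing pz); rewrite last_rcons ec.
by rewrite leNgt (lt_leif (snk_lowest hG z _)) zs.
Qed.

End FirstShared.

Lemma first_shared_exchange sg tau F z : joins sg F -> involutive tau ->
  (forall l, tau l != l -> z \in route F l) ->
  first_shared (exchange_routes tau F) =1 first_shared F.
Proof.
move=> jF tauK zF v.
have sharedE w : shared (exchange_routes tau F) w = shared F w.
  by rewrite /shared (load_exchange_routes jF tauK zF).
rewrite /first_shared sharedE; congr (_ && _).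
by apply: eq_forallb => w; rewrite sharedE.
Qed.

Definition crossing_pair F : option ('I_k * 'I_k) :=
  [pick c : 'I_k * 'I_k | (c.2 == c.1.+1 :> nat) &&
    [exists z, [&& first_shared F z, z \in route F c.1 & z \in route F c.2]]].

Definition exchange (c : 'S_k * family) : 'S_k * family :=
  if crossing_pair c.2 is Some (a, b)
  then ((tperm a b * c.1)%g, exchange_routes (tperm a b) c.2) else c.

Definition ascending (c : 'S_k * family) : bool :=
  if crossing_pair c.2 is Some (a, b) then (c.1 a < c.1 b)%N else false.

Definition crossing (c : 'S_k * family) : bool :=
  joins c.1 c.2 && ~~ noncrossing c.2.

Lemma tperm_moved_mem F a b z : z \in route F a -> z \in route F b ->
  forall l, tperm a b l != l -> z \in route F l.
Proof. by move=> za zb l; case: tpermP => [->|->|_ _]; rewrite ?eqxx. Qed.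

Variant exchange_spec sg F : 'S_k * family -> Prop :=
  Exchange a b z of crossing_pair F = Some (a, b) & b = a.+1 :> nat
    & first_shared F z & z \in route F a & z \in route F b :
  exchange_spec sg F ((tperm a b * sg)%g, exchange_routes (tperm a b) F).

Lemma exchangeP c : crossing c -> exchange_spec c.1 c.2 (exchange c).
Proof.
case: c => sg F /andP[jF /exists_first_shared[z fz]] /=; rewrite /exchange /=.
case pairE: (crossing_pair F) => [[a b]|].
  move: (pairE); rewrite {1}/crossing_pair.
  case: pickP => // -[a' b'] + [aE bE].
  rewrite aE bE => /andP[/eqP ab /existsP[y /and3P[fy ya yb]]].
  exact: Exchange pairE ab fy ya yb.
have /sharedP[l [l' [ll' zl zl']]] : shared F z by case/andP: fz.
wlog lt_l : l l' ll' zl zl' / (l < l')%N => [wlog_lt|].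
  have /orP[] : (l < l')%N || (l' < l)%N by rewrite -neq_ltn.
    exact: wlog_lt.
  by apply: wlog_lt; rewrite // eq_sym.
move: pairE; rewrite /crossing_pair; case: pickP => // /(_ (l, l')) /= + _.
rewrite (first_shared_adjacent jF fz lt_l zl zl') eqxx => /existsP[].
by exists z; rewrite fz zl.
Qed.

Lemma crossing_pair_exchange c : crossing c ->
  crossing_pair (exchange c).2 = crossing_pair c.2.
Proof.
move=> cc; have /andP[jF _] := cc.
case: (exchangeP cc) => a b z _ _ fz za zb /=.
have zF := tperm_moved_mem za zb; have tauK := tpermK a b.
apply: eq_pick => -[l l'] /=; congr (_ && _); apply: eq_existsb => w.
rewrite (first_shared_exchange jF tauK zF).
case fw: (first_shared c.2 w) => //=.
have wz : rank w <= rank z.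
  by have /andP[_ /forallP/(_ z)/implyP] := fw; apply; case/andP: fz.
by rewrite !(mem_exchange_routes jF tauK zF).
Qed.

Lemma exchange_crossing c : crossing c -> crossing (exchange c).
Proof.
move=> cc; have /andP[jF ncF] := cc; case: (exchangeP cc) => a b z _ _ _ za zb.
have zF := tperm_moved_mem za zb; have tauK := tpermK a b.
rewrite /crossing (joins_exchange_routes jF tauK zF) /=.
apply: contra ncF => /forallP nc; apply/forallP => v.
by have := nc v; rewrite /shared (load_exchange_routes jF tauK zF).
Qed.

Lemma exchangeK c : crossing c -> exchange (exchange c) = c.
Proof.
move=> cc; have := crossing_pair_exchange cc; have /andP[jF _] := cc.
case: (exchangeP cc) => a b z -> _ _ za zb /= pairE.
rewrite /exchange /= pairE mulgA tperm2 mul1g.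
rewrite (exchange_routesK jF (tpermK a b) (tperm_moved_mem za zb)).
by rewrite -surjective_pairing.
Qed.

Lemma exchange_ascending c :
  crossing c -> ascending (exchange c) = ~~ ascending c.
Proof.
move=> cc; rewrite /ascending (crossing_pair_exchange cc).
case: (exchangeP cc) => a b z -> ab _ _ _ /=.
rewrite !permM tpermL tpermR -leqNgt.
by rewrite ltn_neqAle (inj_eq val_inj) (inj_eq perm_inj) -val_eqE /= ab gtn_eqF.
Qed.

Section Weights.
Variables (K : fieldType) (q : K) (A : unitAlgType K) (x : V -> A).
Hypotheses (hq : q != 0) (hx : qtorus_rel q x).

Definition signed_weight (c : 'S_k * family) : A :=
  ((- q) ^+ inv_count c.1) *: flow_weight x hI c.2.

Lemma qminor_expansion :
  qminor (pathmx x) q hI hJ = \sum_(c | joins c.1 c.2) signed_weight c.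
Proof.
rewrite -(pair_big_dep xpredT joins (fun sg F => signed_weight (sg, F))) /=.
apply: eq_bigr => sg _; rewrite /signed_weight /= -scaler_sumr; congr (_ *: _).
under eq_bigr do rewrite mxE.
rewrite bigA_distr_big_dep; apply: eq_bigl => F.
by apply/familyP/forallP => jF l; have := jF l.
Qed.

Lemma exchange_weight c : crossing c -> ascending c ->
  signed_weight (exchange c) = - signed_weight c.
Proof.
move=> cc; have /andP[jF _] := cc; rewrite /signed_weight /ascending.
case: (exchangeP cc) => a b z -> ab _ za zb /= asc.
have zF := tperm_moved_mem za zb.
have routeE := exchange_routesE jF (tpermK a b) zF.
have [pa ea] := joinsP a jF; have [pb eb] := joinsP b jF.
have flowE : flow_weight x hI c.2 =
    q *: flow_weight x hI (exchange_routes (tperm a b) c.2).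
  apply: (prod_adjacent_scale ab) => [l la lb|].
    by rewrite routeE tpermD 1?eq_sym // exchange_tails_id.
  rewrite !routeE tpermL tpermR; have src_b := is_src_src G (elt hI b).
  have lt_snk := elt_lt hJ asc.
  exact: (pw_exchange_tails hG hq hx src_b pa pb ea eb lt_snk za zb).
by rewrite flowE (inv_count_tperm ab asc) exprS mulNr scaleNr mulrC scalerA.
Qed.

Lemma sum_crossing_eq0 : \sum_(c | crossing c) signed_weight c = 0.
Proof.
apply: (sum_sign_reversing (up := ascending) (f := exchange)).
- exact: exchange_crossing.
- exact: exchangeK.
- exact: exchange_ascending.
- exact: exchange_weight.
Qed.

Lemma sum_noncrossing :
  \sum_(c | joins c.1 c.2 && noncrossing c.2) signed_weight c =
  \sum_(F | is_flow hI hJ F) flow_weight x hI F.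
Proof.
transitivity (\sum_(c : 'S_k * family | (c.1 == 1%g) && is_flow hI hJ c.2)
                 signed_weight c).
  apply: eq_bigl => -[sg F] /=; rewrite is_flowE.
  apply/andP/and3P => [[jF ncF]|[/eqP->]//].
  by have sg1 := joins_noncrossing_id jF ncF; rewrite -sg1 jF ncF sg1.
rewrite -(pair_big_dep (pred1 1%g) (fun _ => is_flow hI hJ)
  (fun sg F => signed_weight (sg, F))) /= big_pred1_eq.
by apply: eq_bigr => F _; rewrite /signed_weight inv_count1 expr0 scale1r.
Qed.

End Weights.
End Involution.

Theorem theorem3p1 (K : fieldType) (q : K) (hq : q != 0) (m n : nat)
  (G : SEgraph m n) (hG : SE_axioms G)
  (A : unitAlgType K) (x : vert G -> A) (hx : qtorus_rel q x)
  (k : nat) (I : {set 'I_m}) (J : {set 'I_n}) (hI : #|I| = k) (hJ : #|J| = k) :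
  qminor (pathmx x) q hI hJ =
  \sum_(F : {ffun 'I_k -> ptype G} | is_flow hI hJ F) flow_weight x hI F.
Proof.
rewrite qminor_expansion (bigID (fun c => noncrossing c.2)) /=.
by rewrite (sum_noncrossing hG) (sum_crossing_eq0 hG hI hJ hq hx) addr0.
Qed.
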